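(* Let $G$ be a critical graph with $\chi(G) \geq \Delta(G) \geq 6$ and $\omega(\mathcal{H}(G)) \leq \left\lfloor \frac{\Delta(G)}{2} \right\rfloor - 2$. Then $G$ is the complete graph $K_{\chi(G)}$.
   Context: Graphs are finite and simple. $\chi(G)$, $\Delta(G)$, $\omega(G)$ denote the chromatic number, the maximum degree and the clique number of $G$ (the clique number of the graph with no vertices is $0$). A graph $G$ is critical if $\chi(G - v) < \chi(G)$ for every vertex $v$ of $G$. For a graph $G$, $\mathcal{H}(G)$ denotes the subgraph of $G$ induced on the vertices of degree at least $\chi(G)$. *)

(* Defs.v *)
From mathcomp Require Import all_boot.
Set Implicit Arguments.
Unset Strict Implicit.
Unset Printing Implicit Defensive.

Record sgraph := SGraph {
  vertex :> finType;
  adj : rel vertex;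
  adj_sym : symmetric adj;
  adj_irrefl : irreflexive adj
}.

Section Graph.

Variable G : sgraph.
Implicit Types (v : G) (S : {set G}).

Definition degree v : nat := #|[set w | adj v w]|.

(* The maximum over the empty type is 0. *)
Definition max_degree : nat := \max_(v : G) degree v.

Definition clique S : bool :=
  [forall x in S, forall y in S, (x != y) ==> adj x y].

Definition clique_number : nat := \max_(S : {set G} | clique S) #|S|.

Definition colorable (k : nat) : bool :=
  [exists f : {ffun G -> 'I_k}, forall x, forall y, adj x y ==> (f x != f y)].

Lemma colorable_ex : exists k, colorable k.
Proof.
exists #|G|; apply/existsP; exists [ffun x => enum_rank x].
apply/forallP => x; apply/forallP => y; apply/implyP => xy.
rewrite !ffunE (inj_eq enum_rank_inj); apply: contraTneq xy => ->.
by rewrite adj_irrefl.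
Qed.

Definition chromatic_number : nat := ex_minn colorable_ex.

Section Induced.

Variable S : {set G}.

Definition induced_adj : rel {x : G | x \in S} :=
  fun x y => adj (val x) (val y).

Lemma induced_sym : symmetric induced_adj.
Proof. by move=> x y; apply: adj_sym. Qed.

Lemma induced_irrefl : irreflexive induced_adj.
Proof. by move=> x; apply: adj_irrefl. Qed.

Definition induced : sgraph := SGraph induced_sym induced_irrefl.

End Induced.

End Graph.

Definition critical (G : sgraph) : Prop :=
  forall v : G, chromatic_number (induced [set~ v]) < chromatic_number G.

Definition high_subgraph (G : sgraph) : sgraph :=
  induced [set v : G | chromatic_number G <= degree v].

Section Complete.

Variable n : nat.

Definition complete_adj : rel 'I_n := fun i j => i != j.

Lemma complete_sym : symmetric complete_adj.
Proof. by move=> i j; rewrite /complete_adj eq_sym. Qed.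

Lemma complete_irrefl : irreflexive complete_adj.
Proof. by move=> i; rewrite /complete_adj eqxx. Qed.

Definition complete : sgraph := SGraph complete_sym complete_irrefl.

End Complete.

Definition isomorphic (G H : sgraph) : Prop :=
  exists2 f : G -> H, bijective f & forall x y, adj (f x) (f y) = adj x y.

(* Main.v *)
(* Write [k + 1] for the chromatic number, so that degrees are at most [k + 1], and split
   [k = r1 + r2] evenly. In a bipartition of the vertices minimizing Lovasz's weight
   [e(W1) - r1 |W1| + e(W2) - r2 |W2|] every vertex of [Wi] has at most [ri] neighbours in
   [Wi], and since [G] is not [k]-colourable some [Wi] contains a vertex-critical
   non-[ri]-colourable subset (a "bad" set), which is then an [ri]-regular component of
   [Wi]. Among these bipartitions minimize the number of bad sets. Moving a vertex of degree
   [k] out of a bad set to the other side keeps both minima and hence creates a bad set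
   there, so one can move such vertices back and forth forever, following Mozhan. At a
   shortest return of this walk to the remains of a bad set it has left, one finds adjacent
   vertices [x] and [y] of degree [k] in one bad set [Z] which complete the same component
   [D] of the other side to a bad set. Brooks' theorem, or a twin argument when [ri = 2],
   shows that [Z] and [x |: D] are cliques, and their vertices of degree [k] are joined to
   everything. The bound on cliques of vertices of high degree then makes
   [Z :|: D] a clique on [k + 1] vertices, hence the whole graph. *)
Require Import Defs.
From mathcomp Require Import all_boot perm zify.
Set Implicit Arguments.
Unset Strict Implicit.
Unset Printing Implicit Defensive.

(** * Colourings of vertex sets, critical sets and components *)

Section Colouring.

Variable G : sgraph.
Implicit Types (A B S X Z : {set G}) (u v w x y : G).

Definition nbrs v : {set G} := [set w | adj v w].

Definition deg_in S v : nat := #|nbrs v :&: S|.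

Definition proper_on k (f : G -> 'I_k) S : Prop :=
  forall u v, u \in S -> v \in S -> adj u v -> f u <> f v.

Definition colorable_on k S : bool :=
  [exists f : {ffun G -> 'I_k},
     [forall u in S, [forall v in S, adj u v ==> (f u != f v)]]].

(** For [k > 0], such a [Z] induces a vertex-critical graph of chromatic number [k + 1]. *)
Definition crit k Z : bool :=
  ~~ colorable_on k Z && [forall v in Z, colorable_on k (Z :\ v)].

Definition update k (f : G -> 'I_k) v (c : 'I_k) : G -> 'I_k :=
  fun u => if u == v then c else f u.

(** Connectedness in terms of separations; the empty set passes, so [component] excludes it
    separately. *)
Definition indecomposable S : Prop :=
  forall X, X \subset S ->
    (forall u v, u \in X -> v \in S :\: X -> ~~ adj u v) ->
    X = set0 \/ X = S.

Definition component S X : Prop :=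
  [/\ X \subset S, X != set0, indecomposable X
    & forall u v, u \in X -> v \in S -> adj u v -> v \in X].

Lemma adj_neq u v : adj u v -> u != v.
Proof. by apply: contraTneq => ->; rewrite adj_irrefl. Qed.

Lemma colorable_onP k S :
  reflect (exists f : G -> 'I_k, proper_on f S) (colorable_on k S).
Proof.
apply: (iffP existsP) => [[f /'forall_in_forall_inP fP]|[f fP]].
  by exists f => u v uS vS uv; apply/eqP; apply: (implyP (fP u uS v vS)).
exists [ffun u => f u]; apply/'forall_in_forall_inP => u uS v vS.
by apply/implyP => uv; rewrite !ffunE; apply/eqP/fP.
Qed.

Lemma proper_onS k (f : G -> 'I_k) A B :
  A \subset B -> proper_on f B -> proper_on f A.
Proof. by move=> /subsetP AB fP u v /AB uB /AB vB; apply: fP. Qed.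

Lemma proper_update k (f : G -> 'I_k) S v c :
  proper_on f S -> (forall u, u \in S -> adj v u -> f u != c) ->
  proper_on (update f v c) (v |: S).
Proof.
move=> fP cP u w; rewrite !in_setU1 /update.
case: eqP => [->|/eqP uv] /=; case: eqP => [->|/eqP wv] //=.
- by rewrite adj_irrefl.
- by move=> _ wS vw /esym/eqP; apply/negP/cP.
- by move=> uS _; rewrite adj_sym => vu /eqP; apply/negP/cP.
- exact: fP.
Qed.

(** Counting colours instead of neighbours allows for two neighbours of [v] that share a colour. *)
Lemma extend k (f : G -> 'I_k) S v :
  proper_on f S -> #|f @: (nbrs v :&: S)| < k ->
  exists c, proper_on (update f v c) (v |: S).
Proof.
move=> fP lt_k.
have /card_gt0P[c] : 0 < #|~: (f @: (nbrs v :&: S))|.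
  by have := cardsC (f @: (nbrs v :&: S)); rewrite card_ord; lia.
rewrite inE => cP; exists c; apply: proper_update => // u uS vu.
by apply: contraNneq cP => <-; apply: imset_f; rewrite !inE vu.
Qed.

Lemma extend_deg k (f : G -> 'I_k) S v :
  proper_on f S -> deg_in S v < k ->
  exists c, proper_on (update f v c) (v |: S).
Proof.
by move=> fP lt_k; apply: extend => //; apply: leq_ltn_trans (leq_imset_card _ _) lt_k.
Qed.

(** Every edge from [A] to the rest of [B] starts in the overlap, where [f] and [g] agree, so [g]
    takes care of it. *)
Lemma glue k (f g : G -> 'I_k) A B :
  proper_on f A -> proper_on g B ->
  (forall u, u \in A -> u \in B -> f u = g u) ->
  (forall u v, u \in A -> v \in B -> v \notin A -> adj u v -> u \in B) ->
  proper_on (fun u => if u \in A then f u else g u) (A :|: B).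
Proof.
move=> fP gP fg cross u v; rewrite !in_setU.
have [uA _|uA /= uB] := boolP (u \in A); have [vA _|vA /= vB] := boolP (v \in A).
- exact: fP.
- move=> uv; have uB := cross _ _ uA vB vA uv.
  by rewrite fg //; apply: gP.
- rewrite adj_sym => uv; have vB := cross _ _ vA uB uA uv.
  by rewrite fg // => /esym; apply: gP.
- exact: gP.
Qed.

Lemma crit_ncol k Z : crit k Z -> ~ colorable_on k Z.
Proof. by case/andP => /negP. Qed.

Lemma crit_col k Z v : crit k Z -> v \in Z -> exists f : G -> 'I_k, proper_on f (Z :\ v).
Proof. by case/andP => _ /forall_inP H /H /colorable_onP. Qed.

Lemma crit_sub k Z A : crit k Z -> A \subset Z -> A != Z ->
  exists f : G -> 'I_k, proper_on f A.
Proof.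
move=> cZ AZ AnZ.
have [v vZ vA] : exists2 v, v \in Z & v \notin A.
  by apply/subsetPn; apply: contra AnZ => ZA; rewrite eqEsubset AZ.
have [f fP] := crit_col cZ vZ; exists f; apply: proper_onS fP.
apply/subsetP => u uA; rewrite !inE (subsetP AZ) // andbT.
by apply: contraNneq vA => <-.
Qed.

Lemma crit_eq k A Z : crit k Z -> A \subset Z -> ~ colorable_on k A -> A = Z.
Proof.
move=> cZ AZ nA; apply/eqP; apply: contraT => AnZ.
by case: nA; apply/colorable_onP; apply: crit_sub AZ AnZ.
Qed.

Lemma ex_crit k S : ~~ colorable_on k S -> exists2 Z : {set G}, Z \subset S & crit k Z.
Proof.
move=> nS; have [Z /minsetP[nZ minZ] ZS] := @minset_exists _ (fun A => ~~ colorable_on k A) S nS.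
exists Z => //; rewrite /crit nZ; apply/forall_inP => v vZ.
apply: contraT => nZv; have /setP/(_ v) := minZ _ nZv (subsetDl _ _).
by rewrite !inE eqxx vZ.
Qed.

Lemma crit_neq0 k Z : 0 < k -> crit k Z -> Z != set0.
Proof.
move=> k0 cZ; apply: contra_notN (crit_ncol cZ) => /eqP->.
by apply/colorable_onP; exists (fun=> Ordinal k0) => u v; rewrite inE.
Qed.

Lemma crit_deg k Z v : crit k Z -> v \in Z -> k <= deg_in Z v.
Proof.
move=> cZ vZ; rewrite leqNgt; apply: contra_notN (crit_ncol cZ) => lt_k.
have [f fP] := crit_col cZ vZ.
have [||c cP] := @extend_deg k f (Z :\ v) v => //.
  by apply: leq_ltn_trans lt_k; apply: subset_leq_card; apply/setIS/subsetDl.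
by apply/colorable_onP; exists (update f v c); rewrite setD1K in cP.
Qed.

(** Across a separation, colourings of the two proper subsets would combine to one of [Z]. *)
Lemma crit_indecomposable k Z : crit k Z -> indecomposable Z.
Proof.
move=> cZ X XZ sepX.
have [->|[u uX]] := set_0Vmem X; [by left | right].
apply/eqP; apply: contra_notT (crit_ncol cZ) => XnZ.
have [f fP] := crit_sub cZ XZ XnZ.
have [||g gP] := @crit_sub k Z (Z :\: X) cZ; first exact: subsetDl.
  by apply/eqP => /setP/(_ u); rewrite inE uX (subsetP XZ).
apply/colorable_onP; exists (fun u => if u \in X then f u else g u).
rewrite -[Z in proper_on _ Z](setID Z X) (setIidPr XZ); apply: glue => //.
  by move=> w wX; rewrite inE wX.
by move=> w z wX zZ _ wz; have := sepX w z wX zZ; rewrite wz.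
Qed.

(* Otherwise [v] would be a cut vertex: colourings of the two sides can be made to agree at [v]. *)
Lemma crit_del_indecomposable k Z v : crit k Z -> v \in Z -> indecomposable (Z :\ v).
Proof.
move=> cZ vZ X XZ sepX.
have [->|[u uX]] := set_0Vmem X; [by left | right].
have vX : v \notin X by apply/negP => /(subsetP XZ); rewrite !inE eqxx.
have XZ' : X \subset Z by apply: subset_trans XZ (subsetDl _ _).
apply/eqP; apply: contra_notT (crit_ncol cZ) => XnZ.
have [||f fP] := @crit_sub k Z (v |: X) cZ.
- by rewrite subUset sub1set vZ.
- by apply: contra XnZ => /eqP <-; rewrite setU1K.
have [||g gP] := @crit_sub k Z (Z :\: X) cZ; first exact: subsetDl.
  by apply/eqP => /setP/(_ u); rewrite inE uX (subsetP XZ').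
pose h w := tperm (g v) (f v) (g w).
have hP : proper_on h (Z :\: X).
  by move=> a b aZ bZ ab /perm_inj; apply: gP.
apply/colorable_onP; exists (fun u => if u \in v |: X then f u else h u).
have -> : Z = (v |: X) :|: (Z :\: X).
  apply/setP => w; rewrite !inE; case: (eqVneq w v) => [->|] //=.
  by case: (boolP (w \in X)) => // /(subsetP XZ').
apply: glue => //.
- move=> w; rewrite !inE => /orP[/eqP->|->] //= _.
  by rewrite /h tpermL.
- move=> w z; rewrite !inE negb_or => /orP[/eqP->|wX]; first by rewrite vX vZ.
  case/andP=> zX zZ /andP[zv _] wz; have := sepX w z wX.
  by rewrite !inE zX zv zZ wz => /(_ isT).
Qed.

(** As [Y] is closed under adjacency in [S], no edge joins [X :&: Y] to the rest of the
    indecomposable set [X]. *)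
Lemma component_eq S X Y u : component S X -> component S Y ->
  u \in X -> u \in Y -> X = Y.
Proof.
wlog suff H : X Y / component S X -> component S Y -> u \in X -> u \in Y -> X \subset Y.
  by move=> cX cY uX uY; apply/eqP; rewrite eqEsubset !H.
move=> [XS _ iX _] [YS _ _ cY] uX uY.
have [||/setP/(_ u)|<-] := iX (X :&: Y); rewrite ?subsetIl ?subsetIr //.
  move=> a b; rewrite !inE => /andP[_ aY] /andP[bXY bX].
  apply: contra bXY => ab; rewrite bX /=.
  exact: cY aY (subsetP XS _ bX) ab.
by rewrite !inE uX uY.
Qed.

Lemma deg_inU1 S v x : v \notin S -> deg_in (v |: S) x = adj x v + deg_in S x.
Proof.
move=> vS; rewrite /deg_in setIUr cardsU.
have -> : nbrs x :&: [set v] :&: (nbrs x :&: S) = set0.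
  by apply/setP => w; rewrite !inE; case: eqP => [->|]; rewrite ?(negPf vS) ?andbF.
rewrite cards0 subn0; congr (_ + _).
case xv: (adj x v); last first.
  apply/eqP; rewrite cards_eq0; apply/eqP/setP => w; rewrite !inE.
  by case: eqP => [->|]; rewrite ?xv ?andbF.
rewrite (_ : _ :&: _ = [set v]) ?cards1 //; apply/setP => w; rewrite !inE.
by case: eqP => [->|]; rewrite ?xv ?andbF.
Qed.

Lemma cliqueP S :
  reflect (forall u v, u \in S -> v \in S -> u != v -> adj u v) (clique S).
Proof.
apply: (iffP 'forall_in_forall_inP) => [H u v uS vS|H u uS v vS].
  exact/implyP/H.
by apply/implyP; apply: H.
Qed.

Lemma clique_ncol k S : clique S -> k < #|S| -> ~ colorable_on k S.
Proof.
move=> /cliqueP cS lt_k /colorable_onP[f fP].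
have : #|f @: S| <= k by rewrite -[leqRHS](card_ord k) max_card.
rewrite leqNgt card_in_imset ?lt_k // => u v uS vS fuv.
by apply/eqP; apply: contra_eqT fuv => uv; apply/eqP/fP/cS.
Qed.

Lemma deg_clique S v : clique S -> v \in S -> deg_in S v = #|S|.-1.
Proof.
move=> /cliqueP cS vS; rewrite (cardsD1 v) vS; congr #|pred_of_set _|.
apply/setP => u; rewrite !inE; case: eqVneq => [->|uv] /=.
  by rewrite adj_irrefl.
by case: (boolP (u \in S)) => [uS|]; rewrite ?andbF // cS // eq_sym.
Qed.

End Colouring.

(** * Brooks' theorem for critical sets with degrees at most [k] *)

Section Brooks.

Variables (G : sgraph) (k : nat) (Z : {set G}).
Hypotheses (cZ : crit k Z) (degZ : forall u, u \in Z -> deg_in Z u <= k).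
Implicit Types (f g : G -> 'I_k) (u v w x y : G) (C : {set 'I_k}).

(** A colour absent around the uncoloured vertex [v] could be given to [v]. *)
Lemma hole_surj f v c : v \in Z -> proper_on f (Z :\ v) ->
  exists w, [/\ w \in Z, adj v w & f w = c].
Proof.
move=> vZ fP; have [/exists_inP[w wZ /andP[vw /eqP]]|] :=
  boolP [exists w in Z, adj v w && (f w == c)]; first by exists w.
move=> /exists_inPn H; case: (crit_ncol cZ); apply/colorable_onP.
exists (update f v c); rewrite -(setD1K vZ); apply: proper_update => // u.
by rewrite inE => /andP[_ /H]; rewrite negb_and => /orP[/negPf->|].
Qed.

(** By [hole_surj] the at most [k] neighbours of [v] carry all [k] colours, hence each colour
    once. *)
Lemma hole_inj f v u w : v \in Z -> proper_on f (Z :\ v) ->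
  u \in Z -> w \in Z -> adj v u -> adj v w -> f u = f w -> u = w.
Proof.
move=> vZ fP uZ wZ vu vw.
have /imset_injP inj : #|f @: (nbrs v :&: Z)| == #|nbrs v :&: Z|.
  rewrite eqn_leq leq_imset_card /=; apply: leq_trans (degZ vZ) _.
  rewrite -[leqLHS](card_ord k) -cardsT; apply/subset_leq_card/subsetP => c _.
  have [z [zZ vz <-]] := hole_surj c vZ fP.
  by apply: imset_f; rewrite !inE vz.
by apply: inj; rewrite !inE ?vu ?vw.
Qed.

(** The uncoloured vertex [v] is included because it carries a colour of [C] once the hole has moved
    away. *)
Definition in_class f v C : pred G := [pred u | (u == v) || (f u \in C)].

Definition class_adj f v C : rel G :=
  [rel u w | [&& adj u w, w \in Z & in_class f v C w]].

Definition col_adj f v C : rel G :=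
  [rel u w | [&& adj u w, u \in Z :\ v, w \in Z :\ v, f u \in C & f w \in C]].

(* The uncoloured vertex can be moved along any path of vertices coloured from [C],
   each vertex of the path passing its colour to its predecessor. *)
Lemma shift_hole f v C y : v \in Z -> proper_on f (Z :\ v) ->
  connect (class_adj f v C) v y ->
  exists g, [/\ y \in Z, proper_on g (Z :\ y) &
    forall u, u \in Z :\ y ->
      if in_class f v C u then g u \in C else g u == f u].
Proof.
move=> vZ fP /connectP[p pP ->].
pose inv h g := [/\ h \in Z, in_class f v C h, proper_on g (Z :\ h) &
    forall u, u \in Z :\ h -> if in_class f v C u then g u \in C else g u == f u].
suff H h g : inv h g -> path (class_adj f v C) h p -> exists g', inv (last h p) g'.
  have [||g' [? ? ? ?]] // := H v f; last by exists g'.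
  split=> //; first by rewrite /in_class /= eqxx.
  by move=> u /setD1P[/negPf uv _]; rewrite /in_class /= uv /=; case: ifP.
elim: p {pP} h g => [|h' p IH] h g; first by exists g.
move=> [hZ hC gP gC] /= /andP[/and3P[hh' h'Z h'C]]; apply: IH.
have nhh' := adj_neq hh'.
have h'S : h' \in Z :\ h by rewrite !inE eq_sym nhh' h'Z.
split=> //.
  apply: (@proper_onS _ _ (update g h (g h')) _ (h |: (Z :\: [set h; h']))).
    apply/subsetP => u; rewrite !inE => /andP[/negPf-> ->].
    by case: eqVneq.
  apply: proper_update.
    by apply: proper_onS gP; apply/setDS; rewrite sub1set !inE eqxx.
  move=> u; rewrite !inE negb_or => /andP[/andP[uh uh'] uZ] hu.
  apply: contra uh' => /eqP guh'; apply/eqP.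
  exact: hole_inj gP uZ h'Z hu hh' guh'.
move=> u; rewrite !inE /update => /andP[uh' uZ]; case: eqVneq => [->|uh].
  by rewrite hC; have := gC _ h'S; rewrite h'C.
by apply: gC; rewrite !inE uh.
Qed.

Lemma sub_class_adj f v C x y : v \in Z -> x \in Z -> adj v x -> f x \in C ->
  connect (col_adj f v C) x y -> connect (class_adj f v C) v y.
Proof.
move=> vZ xZ vx xC xy; apply: (@connect_trans _ _ x).
  by apply: connect1; rewrite /class_adj /in_class /= vx xZ xC orbT.
apply: connect_sub xy => a b /and5P[ab _ bZ _ bC].
by apply: connect1; case/setD1P: bZ => _ bZ; rewrite /class_adj /in_class /= ab bZ bC orbT.
Qed.

(** Move the hole to [y] along either chain, obtaining [g1] and [g2]. If [v] is not a neighbour of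
    [y], the neighbours of [y] with [g2]-colours [i] and [l] both have [f]-colour [l], which [g1]
    preserves; this contradicts [hole_inj] at [y]. *)
Lemma chains_meet f v i j l y : v \in Z -> proper_on f (Z :\ v) ->
  i != j -> i != l -> j != l -> f y = i -> y != v ->
  connect (class_adj f v [set i; j]) v y ->
  connect (class_adj f v [set i; l]) v y -> adj v y.
Proof.
move=> vZ fP ij il jl fy yv cij cil.
have [g1 [yZ g1P g1C]] := shift_hole vZ fP cij.
have [g2 [_ g2P g2C]] := shift_hole vZ fP cil.
have nbr u : u \in Z -> adj y u -> g2 u \in [set i; l] -> u != v -> f u = l.
  move=> uZ yu g2u uv.
  have uy : u \in Z :\ y by rewrite !inE uZ eq_sym adj_neq.
  have fui : f u != i.
    by rewrite -fy; apply/eqP/fP; rewrite ?inE ?uv ?yv // adj_sym.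
  have : f u \in [set i; l].
    by have := g2C _ uy; rewrite /in_class /= (negPf uv) /=; case: ifP => // nf /eqP gf; rewrite -nf -gf.
  by rewrite !inE (negPf fui) => /eqP.
have [u1 [u1Z yu1 g2u1]] := hole_surj i yZ g2P.
have [u2 [u2Z yu2 g2u2]] := hole_surj l yZ g2P.
rewrite adj_sym; have [<-//|u1v] := eqVneq u1 v; have [<-//|u2v] := eqVneq u2 v.
have f1 : f u1 = l by apply: nbr; rewrite // g2u1 !inE eqxx.
have f2 : f u2 = l by apply: nbr; rewrite // g2u2 !inE eqxx orbT.
have g1l u : u \in Z -> adj y u -> u != v -> f u = l -> g1 u = l.
  move=> uZ yu uv fu; have uy : u \in Z :\ y by rewrite !inE uZ eq_sym adj_neq.
  have := g1C _ uy; rewrite /in_class /= (negPf uv) /= fu !inE.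
  by rewrite [l == i]eq_sym (negPf il) [l == j]eq_sym (negPf jl) => /eqP.
have u12 : u1 = u2.
  by apply: (hole_inj yZ g1P) => //; rewrite !g1l.
by move: il; rewrite -g2u1 -g2u2 u12 eqxx.
Qed.

Definition kempe f v (a b : 'I_k) w : G -> 'I_k :=
  fun u => if connect (col_adj f v [set a; b]) w u then tperm a b (f u) else f u.

Lemma kempe_proper f v a b w : proper_on f (Z :\ v) -> w \in Z :\ v -> f w \in [set a; b] ->
  proper_on (kempe f v a b w) (Z :\ v).
Proof.
move=> fP wS wC; set e := col_adj f v [set a; b].
have inC u : connect e w u -> f u \in [set a; b].
  move=> /connectP[p pP ->]; elim/last_ind: p pP => [|p z _] //.
  by rewrite rcons_path last_rcons => /andP[_ /and5P[]].
have tC c : c \in [set a; b] -> tperm a b c \in [set a; b].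
  by rewrite !inE => /orP[] /eqP->; rewrite ?tpermL ?tpermR eqxx ?orbT.
have out u z : u \in Z :\ v -> z \in Z :\ v -> adj u z ->
    connect e w u -> ~~ connect e w z -> tperm a b (f u) <> f z.
  move=> uS zS uz wu wz E; case/negP: wz; apply: (connect_trans wu).
  by apply: connect1; rewrite /e /col_adj /= uz uS zS -E tC inC.
move=> u z uS zS uz; rewrite /kempe -/e.
case: ifP => wu; case: ifP => wz.
- by move=> /perm_inj; exact: fP.
- by apply: out => //; rewrite wz.
- by move/esym; apply: out; rewrite ?wu // adj_sym.
- exact: fP.
Qed.

(** Otherwise exchanging [a] and [b] on the chain of [wa] alone would leave no neighbour of [v]
    coloured [a]. *)
Lemma kempe_connect f v a b wa wb : v \in Z -> proper_on f (Z :\ v) -> a != b ->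
  wa \in Z -> wb \in Z -> adj v wa -> adj v wb -> f wa = a -> f wb = b ->
  connect (col_adj f v [set a; b]) wa wb.
Proof.
move=> vZ fP ab waZ wbZ vwa vwb fa fb; apply: contraT => ncon.
have waS : wa \in Z :\ v by rewrite !inE waZ eq_sym adj_neq.
have f'P : proper_on (kempe f v a b wa) (Z :\ v).
  by apply: kempe_proper => //; rewrite fa !inE eqxx.
have [w [wZ vw]] := hole_surj a vZ f'P.
rewrite /kempe; case: ifP => con fw.
  have fwb : f w = b by rewrite -[f w](tpermK a b) fw tpermL.
  by rewrite -(hole_inj vZ fP wZ wbZ vw vwb) ?con ?fwb // in ncon.
by rewrite (hole_inj vZ fP wZ waZ vw vwa) ?connect0 ?fw // in con.
Qed.

Lemma col_adj_sym f v C : symmetric (col_adj f v C).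
Proof.
by move=> u w; apply/and5P/and5P => [][]; rewrite adj_sym; split.
Qed.

(* Let [u] follow [w1] on its Kempe chain to [w2]. Exchanging colours on the chain from
   [w1] to a third neighbour puts [u] on two chains ending at [w2], so [u = w2]. *)
Lemma brooks_adj v w1 w2 : 2 < k -> v \in Z -> w1 \in Z -> w2 \in Z ->
  adj v w1 -> adj v w2 -> w1 != w2 -> adj w1 w2.
Proof.
move=> k3 vZ w1Z w2Z vw1 vw2 w12.
have [f fP] := crit_col cZ vZ.
set a := f w1; set b := f w2.
have ab : a != b by apply: contra w12 => /eqP /(hole_inj vZ fP w1Z w2Z vw1 vw2)->.
have [c] : exists c, c \notin [set a; b].
  have /card_gt0P[c] : 0 < #|~: [set a; b]|.
    by have := cardsC [set a; b]; rewrite card_ord cards2; lia.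
  by rewrite inE; exists c.
rewrite !inE negb_or => /andP[ca cb].
have [w3 [w3Z vw3 fw3]] := hole_surj c vZ fP.
have inS w : adj v w -> w \in Z -> w \in Z :\ v.
  by move=> vw wZ; rewrite !inE wZ eq_sym adj_neq.
have con12 := kempe_connect vZ fP ab w1Z w2Z vw1 vw2 erefl erefl.
have con13 : connect (col_adj f v [set a; c]) w1 w3.
  by apply: (kempe_connect vZ fP) => //; rewrite eq_sym.
have f2P : proper_on (kempe f v a c w1) (Z :\ v).
  by apply: kempe_proper; rewrite // ?inS // !inE eqxx.
set f2 := kempe f v a c w1 in f2P.
have f2w1 : f2 w1 = c by rewrite /f2 /kempe connect0 tpermL.
have f2w3 : f2 w3 = a by rewrite /f2 /kempe con13 fw3 tpermR.
have f2b u : f u = b -> f2 u = b.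
  by move=> fu; rewrite /f2 /kempe fu; case: ifP => // _; rewrite tpermD // eq_sym.
(* The path is taken without repetitions so that it does not come back to [w1], which the exchange
   recolours. *)
case/connectP: con12 => p0 p0P p0l; case/shortenP: p0P p0l => [[|u p]] //= .
  by move=> _ _ _ E; rewrite E eqxx in w12.
move=> /andP[w1u pP] /and3P[w1p _ _] _ lp.
case/and5P: (w1u) => adj1u _ uS _ fuC.
have fu : f u = b.
  by move: fuC; rewrite !inE => /orP[] /eqP // fua; case: (fP w1 u) => //; apply: inS.
have [-> //|uw2] := eqVneq w2 u.
have uZ : u \in Z by case/setD1P: uS.
have uv : u != v by case/setD1P: uS.
have f2u := f2b _ fu.
(* A vertex coloured [a] on both chains is a neighbour of [v] by [chains_meet], hence equal to [w1].
   So the exchange spares the rest of the chain with colours [a] and [b]. *)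
have w1con z : connect (col_adj f v [set a; b]) w1 z ->
    f z = a -> z != v -> z != w1 -> ~~ connect (col_adj f v [set a; c]) w1 z.
  move=> abz fza zv zw1; apply/negP => acz.
  have zZ : z \in Z.
    case/connectP: abz => q; case/lastP: q => [_ ->|q z'] //.
    by rewrite rcons_path last_rcons => /andP[_ /and5P[_ _ /setD1P[]]] _ ? _ _ ->.
  have vz : adj v z.
    apply: (@chains_meet f v a b c z) => //; rewrite 1?eq_sym //.
      by apply: sub_class_adj abz => //; rewrite !inE eqxx.
    by apply: sub_class_adj acz => //; rewrite !inE eqxx.
  by rewrite (hole_inj vZ fP zZ w1Z vz vw1 fza) eqxx in zw1.
have keep z : connect (col_adj f v [set a; b]) w1 z -> z \in Z :\ v ->
    f z \in [set a; b] -> z != w1 -> f2 z = f z.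
  move=> abz /setD1P[zv zZ]; rewrite !inE => /orP[] /eqP fz zw1; last by rewrite fz f2b.
  by rewrite /f2 /kempe (negPf (w1con _ abz fz zv zw1)).
have con2u : connect (col_adj f2 v [set b; a]) w2 u.
  rewrite (sym_connect_sym (@col_adj_sym _ _ _)); apply/connectP; exists p => //.
  have w1u' : connect (col_adj f v [set a; b]) w1 u by apply: connect1.
  elim: p u pP w1p {lp adj1u w1u uS fuC fu uw2 uZ uv f2u} w1u' => //= z p IH u.
  rewrite !inE !negb_or => /andP[uz pP] /and3P[w1nu w1z w1p] w1u.
  have w1z' : connect (col_adj f v [set a; b]) w1 z.
    by apply: connect_trans w1u (connect1 uz).
  rewrite IH ?inE ?negb_or ?w1z // andbT.
  case/and5P: uz => uz uS zS fuC fzC.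
  rewrite /col_adj /= uz uS zS !keep // 1?eq_sym //=.
  by rewrite setUC fuC.
have vu : adj v u.
  apply: (@chains_meet f2 v b a c u) => //; rewrite 1?eq_sym //.
    apply: (@sub_class_adj _ _ _ w2) => //.
    by rewrite f2b // !inE eqxx.
  apply: (@sub_class_adj _ _ _ w1) => //; first by rewrite f2w1 !inE eqxx orbT.
  apply: connect1; rewrite /col_adj /= adj1u uS f2u f2w1 !inE !eqxx w1Z /= !orbT eq_sym.
  by rewrite adj_neq.
by have := hole_inj vZ fP uZ w2Z vu vw2 fu => E; rewrite E eqxx in uw2.
Qed.

(** A clique on more than [k] vertices is not [k]-colourable, so it is not a proper subset of the
    critical set [Z]. *)
Lemma clique_nbrs_crit v : v \in Z -> clique (v |: (nbrs v :&: Z)) ->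
  v |: (nbrs v :&: Z) = Z.
Proof.
move=> vZ clN; apply: crit_eq cZ _ _; first by rewrite subUset sub1set vZ subsetIr.
apply: clique_ncol clN _; rewrite cardsU1 !inE adj_irrefl /= add1n ltnS.
exact: crit_deg cZ vZ.
Qed.

Lemma brooks : 2 < k -> clique Z.
Proof.
move=> k3; have /set0Pn[v vZ] : Z != set0 by apply: crit_neq0 cZ; lia.
have clN : clique (v |: (nbrs v :&: Z)).
  apply/cliqueP => u w; rewrite !inE.
  move=> /orP[/eqP->|/andP[vu uZ]] /orP[/eqP->|/andP[vw wZ]] //.
  - by rewrite eqxx.
  - by rewrite adj_sym.
  - exact: brooks_adj vu vw.
by rewrite -(clique_nbrs_crit vZ clN).
Qed.

End Brooks.

(** * Bipartitions of minimum weight and their bad sets *)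

Section Bipartitions.

Variables (G : sgraph) (r : bool -> nat).
Local Notation k := (r true + r false).
Hypotheses (cG : crit k [set: G]) (degG : forall v : G, degree v <= k.+1).
Hypothesis r_gt1 : forall b, 1 < r b.
Implicit Types (P Q : {ffun G -> bool}) (b : bool) (Z S : {set G}) (u v x y : G).

Definition low v := degree v <= k.
Definition part P b : {set G} := [set v | P v == b].
Definition flip P v : {ffun G -> bool} := [ffun u => (u == v) (+) P u].

(* Up to an additive constant, this is twice the sum over both parts of the number of edges
   minus [r b] times the number of vertices. *)
Definition weight P : nat :=
  \sum_v (deg_in (part P (P v)) v + (r (~~ P v)).*2).

Definition bad P b Z : bool := crit (r b) Z && (Z \subset part P b).
Definition nbad P : nat := #|[set p : bool * {set G} | bad P p.1 p.2]|.
Definition light P : bool := [forall Q, weight P <= weight Q].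
Definition optimal P : bool :=
  light P &&
  [forall Q, (weight Q == weight P) ==> (nbad P <= nbad Q)].

Lemma rD b : r b + r (~~ b) = k.
Proof. by case: b; rewrite // addnC. Qed.

Lemma flipK P v : flip (flip P v) v = P.
Proof. by apply/ffunP => u; rewrite !ffunE addbA addbb. Qed.

Lemma flip_self P v : flip P v v = ~~ P v.
Proof. by rewrite ffunE eqxx. Qed.

Lemma part_flip P v : part (flip P v) (P v) = part P (P v) :\ v.
Proof.
apply/setP => u; rewrite !inE ffunE; case: (eqVneq u v) => [->|] //=.
by case: (P v).
Qed.

Lemma part_flipN P v : part (flip P v) (~~ P v) = v |: part P (~~ P v).
Proof.
apply/setP => u; rewrite !inE ffunE; case: (eqVneq u v) => [->|] //=.
exact: eqxx.
Qed.

Lemma degree_part P b v :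
  degree v = deg_in (part P b) v + deg_in (part P (~~ b)) v.
Proof.
rewrite /degree -(cardsID (part P b)); congr (_ + _); apply: eq_card => u.
by rewrite !inE andbC; congr (_ && _); case: (P u); case: b.
Qed.

Lemma weight_flip P v :
  weight (flip P v) + (deg_in (part P (P v)) v + r (~~ P v)).*2 =
  weight P + (deg_in (part P (~~ P v)) v + r (P v)).*2.
Proof.
have nv : v \notin part P (~~ P v) by rewrite inE; case: (P v).
have deg_sum b : \sum_(u | u != v) (adj u v && (P u == b) : nat) = deg_in (part P b) v.
  rewrite -big_mkcondr /= sum1_card; apply: eq_card => u; rewrite !inE.
  rewrite unfold_in /= adj_sym; case: eqVneq => [->|] //=.
  by rewrite adj_irrefl.
(* For a vertex other than [v] the flip changes only whether [v] counts in its degree; each side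
   gets the compensating term. *)
have E : \sum_(u | u != v) (deg_in (part (flip P v) (flip P v u)) u +
      (adj u v && (P u == P v)) + (r (~~ flip P v u)).*2) =
    \sum_(u | u != v) (deg_in (part P (P u)) u +
      (adj u v && (P u == ~~ P v)) + (r (~~ P u)).*2).
  apply: eq_bigr => u uv; have -> : flip P v u = P u by rewrite ffunE (negPf uv).
  congr (_ + _); case: (eqVneq (P u) (P v)) => [->|Puv].
    have -> : (P v == ~~ P v) = false by case: (P v).
    rewrite part_flip andbT andbF addn0 -[in RHS](@setD1K _ v (part P (P v))) ?inE //.
    by rewrite deg_inU1 ?setD11 // addnC.
  have -> : P u = ~~ P v by move: Puv; case: (P u); case: (P v).
  by rewrite part_flipN deg_inU1 // eqxx andbT andbF addn0 addnC.
move: E; rewrite !big_split /= !deg_sum => E.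
rewrite /weight (bigD1 v) //= [in RHS](bigD1 v) //= !big_split /=.
rewrite flip_self negbK part_flipN deg_inU1 // adj_irrefl.
by move: E; lia.
Qed.

Lemma ex_optimal : exists P, optimal P.
Proof.
case: (@arg_minnP _ [ffun=> true] xpredT weight isT) => P1 _ min1.
case: (@arg_minnP _ P1 (fun P => weight P == weight P1) nbad (eqxx _)) => P /eqP wP minP.
exists P; apply/andP; split; apply/forallP => Q; first by rewrite wP min1.
by apply/implyP; rewrite wP; apply: minP.
Qed.

(** Otherwise disjoint palettes of [r true] and [r false] colours would colour [G]. *)
Lemma ex_bad P : exists b Z, bad P b Z.
Proof.
have [colT|/ex_crit[Z ZP cZ]] := boolP (colorable_on (r true) (part P true)); last first.
  by exists true, Z; rewrite /bad cZ.
have [colF|/ex_crit[Z ZP cZ]] := boolP (colorable_on (r false) (part P false)); last first.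
  by exists false, Z; rewrite /bad cZ.
case: (crit_ncol cG); apply/colorable_onP.
have [/colorable_onP[f fP] /colorable_onP[g gP]] := (colT, colF).
pose h u : 'I_k := match P u with true => lshift _ (f u) | false => rshift _ (g u) end.
exists h => u v _ _ uv; rewrite /h.
case Pu: (P u); case Pv: (P v).
- by move/lshift_inj; apply: fP; rewrite // inE ?Pu ?Pv.
- by move/eqP; rewrite eq_lrshift.
- by move/eqP; rewrite eq_rlshift.
- by move/rshift_inj; apply: gP; rewrite // inE ?Pu ?Pv.
Qed.

(** Otherwise flipping [v] would lower the weight. The extra 1 in the degree bound [k.+1] is
    absorbed by parity. *)
Lemma light_deg P v : light P -> deg_in (part P (P v)) v <= r (P v).
Proof.
move=> /forallP/(_ (flip P v)) wP.
have := weight_flip P v; have := degG v; rewrite (degree_part P (P v)).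
by have := rD (P v); lia.
Qed.

Lemma low_degree v : low v -> degree v = k.
Proof.
rewrite /low => lv; apply/eqP; rewrite eqn_leq lv.
by have := crit_deg cG (in_setT v); rewrite /deg_in setIT.
Qed.

Section Bad.

Variables (P : {ffun G -> bool}) (b : bool) (Z : {set G}).
Hypotheses (lightP : light P) (badZ : bad P b Z).

Let cZ : crit (r b) Z. Proof. by case/andP: badZ. Qed.
Let ZP : Z \subset part P b. Proof. by case/andP: badZ. Qed.

Lemma bad_part v : v \in Z -> P v = b.
Proof. by move/(subsetP ZP); rewrite inE => /eqP. Qed.

Lemma bad_part_deg v : v \in Z -> deg_in (part P b) v = r b.
Proof.
move=> vZ; apply/eqP; rewrite eqn_leq; apply/andP; split.
  by rewrite -(bad_part vZ) light_deg.
by apply: leq_trans (crit_deg cZ vZ) _; apply/subset_leq_card/setIS.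
Qed.

Lemma bad_deg v : v \in Z -> deg_in Z v = r b.
Proof.
move=> vZ; apply/eqP; rewrite eqn_leq crit_deg // andbT -(bad_part_deg vZ).
exact/subset_leq_card/setIS.
Qed.

Lemma bad_closed u v : u \in Z -> v \in part P b -> adj u v -> v \in Z.
Proof.
move=> uZ vP uv.
have /eqP/setP/(_ v) : nbrs u :&: Z == nbrs u :&: part P b.
  by rewrite eqEcard setIS //= -/(deg_in _ _) -/(deg_in Z _) bad_deg // bad_part_deg.
by rewrite !inE uv /= => ->; move: vP; rewrite inE.
Qed.

Lemma bad_nbr v : v \in Z -> exists2 u, u \in Z & adj v u.
Proof.
move=> vZ; have /card_gt0P[u] : 0 < deg_in Z v by rewrite bad_deg // ltnW.
by rewrite !inE => /andP[vu uZ]; exists u.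
Qed.

Lemma bad_component : component (part P b) Z.
Proof.
split=> //; last exact: bad_closed.
  by apply: crit_neq0 cZ; apply: ltnW.
exact: crit_indecomposable cZ.
Qed.

Lemma bad_del_component v : v \in Z -> component (part (flip P v) b) (Z :\ v).
Proof.
move=> vZ; have Pv := bad_part vZ; rewrite -[in part _ _]Pv part_flip Pv.
split; first exact: setSD.
- have [u uZ vu] := bad_nbr vZ; apply/set0Pn; exists u.
  by rewrite !inE uZ eq_sym adj_neq.
- exact: crit_del_indecomposable cZ vZ.
- move=> u w /setD1P[_ uZ] /setD1P[wv wP] uw; apply/setD1P; split=> //.
  exact: bad_closed uw.
Qed.

End Bad.

Lemma bad_uniq P b Z Z' u : light P -> bad P b Z -> bad P b Z' ->
  u \in Z -> u \in Z' -> Z = Z'.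
Proof. by move=> oP /(bad_component oP) cZ /(bad_component oP); apply: component_eq. Qed.

(** The [k] neighbours of [v] split as [r b] and [r (~~ b)], so the weight is unchanged. The move
    destroys [Z], and any new bad set contains [v]; minimality of [nbad] forces one to appear, and
    disjointness allows only one. *)
Lemma bad_move P b Z v : optimal P -> bad P b Z -> v \in Z -> low v ->
  optimal (flip P v) /\ exists2 Z', bad (flip P v) (~~ b) Z' & v \in Z'.
Proof.
move=> oP bZ vZ lv; have Pv := bad_part bZ vZ; set P' := flip P v.
have /andP[lP /forallP minb] := oP; have minw := forallP lP.
have wP' : weight P' = weight P.
  have := weight_flip P v; rewrite -/P' Pv (bad_part_deg lP bZ vZ).
  have := low_degree lv; rewrite (degree_part P b) (bad_part_deg lP bZ vZ).
  by have := rD b; lia.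
have lP' : light P' by apply/forallP => Q; rewrite wP'.
have bad_same Y : bad P' b Y -> bad P b Y /\ Y != Z.
  rewrite /bad -[b in part _ b]Pv part_flip Pv => /andP[-> /subsetP YP].
  split; last by apply/eqP => E; have := YP v; rewrite E !inE eqxx vZ => /(_ isT).
  by apply/subsetP => u /YP /setD1P[].
have bad_other Y : bad P' (~~ b) Y -> v \notin Y -> bad P (~~ b) Y.
  have := part_flipN P v; rewrite Pv /bad => -> /andP[-> /subsetP YP] vY.
  apply/subsetP => u uY; have := YP u uY; rewrite in_setU1 => /orP[/eqP E|//].
  by rewrite -E uY in vY.
pose B := [set p : bool * {set G} | bad P p.1 p.2].
pose B' := [set p : bool * {set G} | bad P' p.1 p.2].
have le_nbad : nbad P <= nbad P' by apply: (implyP (minb _)); rewrite wP'.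
have [Z' bZ' vZ'] : exists2 Z', bad P' (~~ b) Z' & v \in Z'.
  have [/existsP[Z' /andP[bZ' vZ']]|/existsPn noZ'] :=
    boolP [exists Z', bad P' (~~ b) Z' && (v \in Z')]; first by exists Z'.
  suff : nbad P' < nbad P by rewrite ltnNge le_nbad.
  apply: proper_card; apply/properP; split; last first.
    exists (b, Z); rewrite inE //=.
    by apply: contraTN bZ => /bad_same[_ /eqP].
  apply/subsetP => -[c Y]; rewrite !inE /=.
  have [->|cb] := eqVneq c b; first by case/bad_same.
  have -> : c = ~~ b by move: (c) (b) cb => [] [].
  move=> bY; apply: bad_other => //.
  by apply: contraTN (noZ' Y) => vY; rewrite bY vY.
split; last by exists Z'.
rewrite /optimal lP'; apply/forallP => Q; rewrite wP'.
apply/implyP => wQ; apply: leq_trans (implyP (minb Q) wQ).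
rewrite /nbad -/B -/B'.
have : B' \subset (~~ b, Z') |: (B :\ (b, Z)).
  apply/subsetP => -[c Y]; rewrite !inE /=.
  have [->|cb] := eqVneq c b.
    by case/bad_same => -> YZ; rewrite !xpair_eqE eqxx YZ orbT.
  have -> : c = ~~ b by move: (c) (b) cb => [] [].
  move=> bY; rewrite !xpair_eqE eqxx /=.
  have [//|YZ'] := eqVneq Y Z'.
  rewrite bad_other ?andbT //; first by case: (b).
  by apply: contra YZ' => vY; apply/eqP/(bad_uniq lP' bY bZ' vY vZ').
move/subset_leq_card/leq_trans; apply; rewrite cardsU1 (cardsD1 (b, Z) B).
by have -> : (b, Z) \in B; [rewrite inE | rewrite leq_add2r leq_b1].
Qed.

Lemma neq_negb (c d : bool) : c != d -> c = ~~ d.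
Proof. by case: c; case: d. Qed.

Lemma optimal_light P : optimal P -> light P.
Proof. by case/andP. Qed.

(** In both bad sets [w] has degree [r b], and these sets differ only in [u] and [v]. *)
Lemma adj_exchange b (A : {set G}) u v w P Q :
  light P -> light Q -> bad P b (u |: A) -> bad Q b (v |: A) ->
  u \notin A -> v \notin A -> w \in A -> adj w u = adj w v.
Proof.
move=> lP lQ bP bQ uA vA wA.
have := bad_deg lP bP (setU1r u wA); rewrite -(bad_deg lQ bQ (setU1r v wA)).
by rewrite !deg_inU1 // => /addIn; case: (adj w u); case: (adj w v).
Qed.

(** The vertex [z] makes the situation symmetric: once [x] has moved across, [z] plays the role of
    [y] and [Z :\ x] that of [D]. *)
Record config P b Z x y (D : {set G}) z : Prop := Config {
  config_opt : optimal P;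
  config_bad : bad P b Z;
  config_x : x \in Z;
  config_y : y \in Z;
  config_low_x : low x;
  config_low_y : low y;
  config_adj : adj x y;
  config_D : D \subset part P (~~ b);
  config_crit_x : crit (r (~~ b)) (x |: D);
  config_crit_y : crit (r (~~ b)) (y |: D);
  config_z : z \in D;
  config_low_z : low z;
  config_adj_z : adj x z
}.

(** * Mozhan's walk and its shortest return *)

Section Walk.

Variables (P : nat -> {ffun G -> bool}) (b : nat -> bool).
Variables (Z : nat -> {set G}) (y : nat -> G).
Hypothesis optP : forall n, optimal (P n).
Hypothesis badZ : forall n, bad (P n) (b n) (Z n).
Hypothesis yZ : forall n, y n \in Z n.
Hypothesis low_y : forall n, low (y n).
Hypothesis nbr_y : forall n, exists x, [/\ x \in Z n, low x & adj x (y n)].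
Hypothesis PS : forall n, P n.+1 = flip (P n) (y n).
Hypothesis bS : forall n, b n.+1 = ~~ b n.
Hypothesis yZS : forall n, y n \in Z n.+1.
Hypothesis yS : forall n, y n.+1 != y n.

Let lightP n : light (P n). Proof. exact: optimal_light. Qed.

Lemma part_next n c : part (P n.+1) c =
  if c == b n then part (P n) c :\ y n else y n |: part (P n) c.
Proof.
have Py := bad_part (badZ n) (yZ n); rewrite PS; case: eqVneq => [->|cb].
  by have := part_flip (P n) (y n); rewrite Py.
rewrite (neq_negb cb).
by have := part_flipN (P n) (y n); rewrite Py.
Qed.

Lemma component_left n : component (part (P n.+1) (b n)) (Z n :\ y n).
Proof. by rewrite PS; apply: bad_del_component. Qed.

(** Read backwards, the step takes [y n] out of the bad set [Z n.+1]. *)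
Lemma component_right n : component (part (P n) (~~ b n)) (Z n.+1 :\ y n).
Proof.
have := bad_del_component (lightP n.+1) (badZ n.+1) (yZS n).
by rewrite PS flipK bS.
Qed.

(** A step affects [X] only if the moved vertex leaves [X] or becomes adjacent to it; either way
    some bad set visited on side [c] meets [X]. *)
Lemma component_persist m n c X : m <= n -> component (part (P m) c) X ->
  (forall j u, m <= j <= n -> b j = c -> u \in X -> u \notin Z j) ->
  component (part (P n) c) X.
Proof.
elim: n => [|n IH]; first by rewrite leqn0 => /eqP->.
rewrite leq_eqVlt ltnS => /orP[/eqP->//|mn] cX XZ.
have [|XS X0 iX clX] := IH mn cX.
  by move=> j u /andP[mj jn]; apply: XZ; rewrite mj leqW.
split=> //; rewrite part_next; case: eqVneq => cb.
- rewrite subsetD1 XS; apply/negP => yX.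
  by have := XZ n (y n); rewrite mn leqnSn yZ => /(_ isT (esym cb) yX).
- exact: subset_trans XS (subsetUr _ _).
- move=> u v uX /setD1P[_ vS]; exact: clX.
- move=> u v uX /setU1P[->|]; last exact: clX.
  have bc : b n.+1 = c by rewrite bS (neq_negb cb).
  move=> uy; suff uZ : u \in Z n.+1.
    by have := XZ n.+1 u; rewrite leqnn (leqW mn) uZ => /(_ isT bc uX).
  apply: (bad_closed (lightP _) (badZ _) (yZS n)); last by rewrite adj_sym.
  by rewrite bc part_next (negPf cb) setU1r // (subsetP XS).
Qed.

Section Closed.

(* At time [t.+1] the walk returns to what is left of the bad set it visited at time [s]. *)
Variables s t : nat.
Hypotheses (st : s < t) (bt : b t = ~~ b s).
Hypothesis return_st : exists u, [/\ u \in Z s, u != y s & u \in Z t.+1].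
Hypothesis first_return : forall s' t' u, s' < t' <= t.+1 -> t' - s' <= t - s ->
  b s' = b t' -> u \in Z s' -> u != y s' -> u \notin Z t'.

(** Here [z] is the vertex [y t] whose move closes the return, [x] is a low neighbour of [y s], and
    [D] is what [x] would complete by moving at time [s] in place of [y s]. *)
Lemma walk_config : exists x D z, config (P s) (b s) (Z s) x (y s) D z.
Proof.
set i := b s; set z := y t.
have zt : z \in part (P t) (~~ i).
  by rewrite inE (bad_part (badZ t) (yZ t)) bt.
(* Had [z] arrived by the move at time [j], then [Z j.+1] and [Z t] would both contain it: a shorter
   return, or [y t = y j] when [t = j.+1]. *)
have zS j : s <= j <= t -> z \in part (P j) (~~ i).
  move=> /andP[sj jt]; have [d def_t] : exists d, t = j + d by exists (t - j); lia.
  elim: d j sj jt def_t => [|d IH] j sj jt def_t.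
    by have -> : j = t by lia.
  have := IH j.+1 (leqW sj); rewrite part_next => /(_ ltac:(lia) ltac:(lia)).
  case: eqVneq => [_ /setD1P[]//|bj /setU1P[zy|//]].
  have bj1 : b j.+1 = b t by rewrite bt bS; move: bj; case: (b j); rewrite -/i; case: (i).
  have zy' : z != y j.+1 by rewrite zy eq_sym.
  have [jt1|jt1] := ltnP j.+1 t.
    have /negP[] := @first_return j.+1 t z ltac:(by rewrite jt1 leqnSn) (leq_sub2l _ (leqW sj)) bj1 ltac:(by rewrite zy) zy'.
    exact: yZ.
  by have := zy'; rewrite /z (_ : t = j.+1) ?eqxx //; apply/eqP; rewrite eqn_leq jt1 def_t addnS ltnS leq_addr.
(* No earlier return disturbs the remains of [Z s], so they are the component that [z] joins at time
   [t]. *)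
have KZ : Z t.+1 :\ z = Z s :\ y s.
  have [u [us uy ut]] := return_st.
  have ct : component (part (P t) i) (Z t.+1 :\ z).
    by have := component_right t; rewrite bt negbK.
  have cs : component (part (P t) i) (Z s :\ y s).
    apply: component_persist (component_left s) _ => // j w /andP[sj jt] bj /setD1P[wy wZ].
    by apply: first_return wZ wy; rewrite ?sj ?(leqW jt) ?leq_sub2r.
  apply: (component_eq ct cs (u := u)); rewrite !inE ?us ?uy ?ut // andbT.
  apply/eqP => uz; have := zS s; rewrite leqnn ltnW // -uz inE (bad_part (badZ s) us).
  by move/(_ isT); rewrite -/i; case: (i).
have [x [xs low_x xy]] := nbr_y s.
have xny : x != y s := adj_neq xy.
have xK : x \in Z s :\ y s by rewrite !inE xny.
have zK : z \notin Z s :\ y s by rewrite -KZ setD11.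
have xt : x \in Z t.+1 by move: xK; rewrite -KZ => /setD1P[].
have xz : adj x z.
  rewrite -(@adj_exchange i (Z s :\ y s) (y s) z x (P s) (P t.+1)) // ?setD11 //.
    by rewrite setD1K.
  by rewrite -KZ (setD1K (yZS t)); have := badZ t.+1; rewrite bS bt negbK.
have [optPx [Zx badZx xZx]] := bad_move (optP s) (badZ s) xs low_x.
have cDx : component (part (P s) (~~ i)) (Zx :\ x).
  have := bad_del_component (optimal_light optPx) badZx xZx.
  by rewrite flipK.
set D := Zx :\ x in cDx.
have zD : z \in D.
  rewrite !inE eq_sym adj_neq //=.
  apply: (bad_closed (optimal_light optPx) badZx xZx) => //.
  have := part_flipN (P s) x; rewrite (bad_part (badZ s) xs) => ->.
  by rewrite setU1r // zS // leqnn ltnW.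
(* If some [Z l.+1] met [D], it would be [D] together with [y l] and so contain [z]; the visit to
   [z] at time [t] would then be a shorter return. *)
have lateD j : s <= j < t -> component (part (P j) (~~ i)) D.
  move=> sjt; elim/ltn_ind: j sjt => j IH /andP[sj jt].
  apply: component_persist sj cDx _ => -[|l] u /andP[sl lj] bl uD.
    by move: sl bl; rewrite leqn0 => /eqP<-; rewrite -/i; case: (i).
  have sl' : s <= l.
    by move: sl bl; rewrite leq_eqVlt => /orP[/eqP<-|//]; rewrite -/i; case: (i).
  have bl' : b l = i by move: bl; rewrite bS => /negb_inj.
  have cl : component (part (P l) (~~ i)) D by apply: IH; rewrite ?lj // sl' (ltn_trans lj jt).
  have cr : component (part (P l) (~~ i)) (Z l.+1 :\ y l).
    by have := component_right l; rewrite bl'.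
  apply/negP => uZ.
  have Dl : D = Z l.+1 :\ y l.
    apply: (component_eq cl cr uD); rewrite !inE uZ andbT.
    apply: contraTneq uD => ->; have [/subsetP DS _ _ _] := cl.
    by apply/negP => /DS; rewrite inE (bad_part (badZ l) (yZ l)) bl'; case: (i).
  have zl : z \in Z l.+1 by move: zD; rewrite Dl => /setD1P[].
  have zyl : z != y l.+1.
    have := zS l.+2; rewrite part_next bl eqxx !leqW // (leq_ltn_trans lj jt) => /(_ isT).
    by case/setD1P.
  by have /negP[] := @first_return l.+1 t z ltac:(by rewrite (leq_ltn_trans lj jt) leqnSn) (leq_sub2l _ (leqW sl')) (etrans bl (esym bt)) zl zyl;
    apply: yZ.
have [t' def_t] : exists t', t = t'.+1 by exists t.-1; rewrite prednK // (leq_ltn_trans _ st).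
have bt' : b t' = i by move: bt; rewrite def_t bS => /negb_inj.
have zt' : z \in Z t :\ y t'.
  by rewrite !inE yZ andbT /z def_t yS.
have DZt : D = Z t :\ y t'.
  apply: (component_eq (S := part (P t') (~~ i)) _ _ zD zt').
    by apply: lateD; rewrite def_t ltnSn -ltnS -def_t st.
  by have := component_right t'; rewrite bt' -def_t.
(* This yields [config_crit_y]: what [y s] did join is what [x] would have joined. *)
have DE : D = Z s.+1 :\ y s.
  have [ts1|ss'] := eqVneq t s.+1.
    by rewrite DZt ts1; congr (_ :\ y _); apply: succn_inj; rewrite -def_t.
  (* At time [t.+1] the remains of [Z s.+1] and of [Z t] are components of the same side, and [x]
     has a neighbour in each, [y s] and [w]. Moving [x] completes a single component, so the two
     coincide and [y s] lies in [Z t], a shorter return. *)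
  exfalso.
  have cK1 : component (part (P t.+1) (~~ i)) (Z s.+1 :\ y s.+1).
    have := component_left s.+1; rewrite bS -/i => cl.
    apply: component_persist cl _; first exact: st.
    move=> j u /andP[sj jt1] bj /setD1P[uy uZ]; have jt : j <= t.
      rewrite leqNgt; apply/negP => tj; have : b t.+1 = ~~ i by rewrite -bj; congr b; apply/eqP; rewrite eqn_leq tj jt1.
      by rewrite bS bt negbK -/i; case: (i).
    by apply: first_return uZ uy; rewrite ?bS ?bj ?sj ?jt1 ?leq_sub.
  have yK1 : y s \in Z s.+1 :\ y s.+1 by rewrite !inE yZS eq_sym yS.
  have cKt : component (part (P t.+1) (~~ i)) (Z t :\ y t).
    by have := component_left t; rewrite bt.
  have bt1 : b t.+1 = i by rewrite bS bt negbK.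
  have [optQ [Zq badZq xZq]] := bad_move (optP t.+1) (badZ t.+1) xt low_x.
  have cQ : component (part (P t.+1) (~~ i)) (Zq :\ x).
    have := bad_del_component (optimal_light optQ) badZq xZq.
    by rewrite flipK bt1.
  have adj_in w : adj x w -> w \in part (P t.+1) (~~ i) -> w \in Zq :\ x.
    move=> xw wS; rewrite !inE eq_sym adj_neq //=.
    apply: (bad_closed (optimal_light optQ) badZq xZq) => //.
    have := part_flipN (P t.+1) x; rewrite (bad_part (badZ t.+1) xt) => ->.
    by rewrite setU1r // bt1.
  (* In [Zx] the vertex [x] has [r (~~ i) > 1] neighbours, hence one besides [z]. *)
  have [w wD [wz xw]] : exists2 w, w \in D & w != z /\ adj x w.
    have : 1 < deg_in Zx x by rewrite (bad_deg (optimal_light optPx) badZx xZx).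
    rewrite /deg_in (cardsD1 z) => lt1.
    have /card_gt0P[w] : 0 < #|(nbrs x :&: Zx) :\ z| by by rewrite -ltnS (leq_trans lt1) // -add1n leq_add2r leq_b1.
    rewrite !inE => /and3P[wz xw wZ]; exists w => //.
    by rewrite !inE eq_sym adj_neq.
  have wKt : w \in Z t :\ y t.
    by rewrite !inE wz; move: wD; rewrite DZt => /setD1P[].
  have [/subsetP K1S _ _ _] := cK1; have [/subsetP KtS _ _ _] := cKt.
  have E1 : Zq :\ x = Z s.+1 :\ y s.+1.
    apply: (component_eq cQ cK1 (u := y s)) => //.
    by apply: adj_in => //; apply: K1S.
  have E2 : Zq :\ x = Z t :\ y t.
    apply: (component_eq cQ cKt (u := w)) => //.
    by apply: adj_in => //; apply: KtS.
  have /negP[] := @first_return s.+1 t (y s) ltac:(by rewrite leqnSn ltn_neqAle eq_sym ss' st)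
    (leq_sub2l _ (leqnSn s))
    ltac:(by rewrite bS bt) (yZS s) ltac:(by rewrite eq_sym).
  by move: yK1; rewrite -E1 E2 => /setD1P[].
exists x, D, z; split=> //.
- by case: cDx.
- by rewrite setD1K //; case/andP: badZx.
- rewrite DE setD1K //; by have /andP[] := badZ s.+1; rewrite bS.
- exact: low_y.
Qed.

End Closed.
End Walk.

(** * Existence of the walk and of a configuration *)

Hypothesis ex_adj_low : forall P b Z, light P -> bad P b Z ->
  exists x y, [/\ x \in Z, y \in Z, low x, low y & adj x y].

Local Notation state := ({ffun G -> bool} * bool * {set G} * G)%type.
Local Notation stP := (fun s : state => s.1.1.1).
Local Notation stb := (fun s : state => s.1.1.2).
Local Notation stZ := (fun s : state => s.1.2).
Local Notation sty := (fun s : state => s.2).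

Definition good_state (s : state) : bool :=
  [&& optimal (stP s), bad (stP s) (stb s) (stZ s), sty s \in stZ s, low (sty s) &
      [exists x, [&& x \in stZ s, low x & adj x (sty s)]]].

Definition next_state (s s' : state) : bool :=
  [&& stP s' == flip (stP s) (sty s), stb s' == ~~ stb s, sty s \in stZ s' &
      sty s' != sty s].

(** Of two adjacent low vertices at least one differs from [v], the vertex just moved; the other
    serves as its low neighbour. *)
Lemma ex_good_state P b Z v : optimal P -> bad P b Z ->
  exists y, good_state (P, b, Z, y) && (y != v).
Proof.
move=> oP bZ; have [x [y [xZ yZ lx ly xy]]] := ex_adj_low (optimal_light oP) bZ.
have [yv|yv] := eqVneq y v; [exists x | exists y].
  rewrite -yv adj_neq // andbT /good_state /= oP bZ xZ lx /=.
  by apply/existsP; exists y; rewrite yZ ly adj_sym.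
rewrite yv andbT /good_state /= oP bZ yZ ly /=.
by apply/existsP; exists x; rewrite xZ lx.
Qed.

Lemma ex_next_state s : good_state s -> exists s', good_state s' && next_state s s'.
Proof.
case: s => [[[P b] Z] y] /and5P[/= oP bZ yZ ly _].
have [oP' [Z' bZ' yZ']] := bad_move oP bZ yZ ly.
have [y' /andP[gs yy']] := ex_good_state y oP' bZ'.
by exists (flip P y, ~~ b, Z', y'); rewrite gs /next_state /= !eqxx yZ' yy'.
Qed.

Lemma ex_walk : exists w : nat -> state,
  forall n, good_state (w n) /\ next_state (w n) (w n.+1).
Proof.
have [P0 oP0] := ex_optimal; have [b0 [Z0 bZ0]] := ex_bad P0.
have /set0Pn[v _] : Z0 != set0.
  by case/andP: bZ0 => /crit_neq0->//; apply: ltnW.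
have [y0 /andP[gs0 _]] := ex_good_state v oP0 bZ0.
(* By [ex_next_state] the default value is never taken at a good state. *)
pose step s := odflt s [pick s' | good_state s' && next_state s s'].
have stepP s : good_state s -> good_state (step s) /\ next_state s (step s).
  move=> /ex_next_state[s' gs']; rewrite /step.
  by case: pickP => [s'' /andP[]|/(_ s')] //; rewrite gs'.
have good_iter n : good_state (iter n step (P0, b0, Z0, y0)).
  by elim: n => [|n /stepP[]].
by exists (fun n => iter n step (P0, b0, Z0, y0)) => n; split=> //; case: (stepP _ (good_iter n)).
Qed.

Lemma ex_config : exists P b Z x y D z, config P b Z x y D z.
Proof.
have [w wP] := ex_walk.
pose Pn n := stP (w n); pose bn n := stb (w n); pose Zn n := stZ (w n); pose yn n := sty (w n).
have optP n : optimal (Pn n) by have [/and5P[]] := wP n.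
have badZ n : bad (Pn n) (bn n) (Zn n) by have [/and5P[]] := wP n.
have yZ n : yn n \in Zn n by have [/and5P[]] := wP n.
have low_y n : low (yn n) by have [/and5P[]] := wP n.
have nbr_y n : exists x, [/\ x \in Zn n, low x & adj x (yn n)].
  by have [/and5P[_ _ _ _ /existsP[x /and3P[]]]] := wP n; exists x.
have PS n : Pn n.+1 = flip (Pn n) (yn n) by have [_ /and4P[/eqP]] := wP n.
have bS n : bn n.+1 = ~~ bn n by have [_ /and4P[_ /eqP]] := wP n.
have yZS n : yn n \in Zn n.+1 by have [_ /and4P[]] := wP n.
have yS n : yn n.+1 != yn n by have [_ /and4P[]] := wP n.
pose returns s t := (bn s == bn t) && [exists u, [&& u \in Zn s, u != yn s & u \in Zn t]].
have [s0 [t0 [st0 ret0]]] : exists s t, s < t /\ returns s t.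
  (* There are finitely many states, so one recurs; a recurrence is a return because [yn i] has a
     neighbour in [Zn i]. *)
  have /injectivePn[i [j ij wij]] : ~~ injectiveb (fun i : 'I_#|{: state}|.+1 => w i).
    by apply/injectiveP => /leq_card; rewrite card_ord ltnn.
  wlog lt_ij : i j ij wij / i < j.
    move=> H; have [|le_ji] := ltnP i j; first exact: H.
    by apply: (H j i); rewrite // 1?eq_sym // ltn_neqAle le_ji eq_sym ij.
  exists i, j; split=> //; rewrite /returns /bn /Zn wij eqxx /=.
  have [x [xZ _ xy]] := nbr_y i.
  by apply/existsP; exists x; move: xZ; rewrite /Zn wij (adj_neq xy) => ->.
have [d def_d] : exists d, t0 - s0 = d by exists (t0 - s0).
(* Induction on the gap: either a return with smaller gap ends no later, or [walk_config]
   applies. *)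
elim/ltn_ind: d s0 t0 def_d st0 ret0 => d IH s [|t] def_d st // ret_st.
have [/existsP[[t' t'_lt] /existsP[[s' s'_lt] /= /and3P[s't' gap ret']]]|no_ret] :=
  boolP [exists t' : 'I_t.+2, exists s' : 'I_t.+2, [&& s' < t', t' - s' <= t - s & returns s' t']].
  by apply: (IH (t' - s')) ret' => //; lia.
have [/eqP bst /existsP[u /and3P[us uy ut]]] := andP ret_st.
have bt : bn t = ~~ bn s by rewrite bst bS negbK.
have lt_st : s < t.
  by rewrite ltn_neqAle -ltnS st andbT; apply: contra_eqN bt => /eqP->; case: (bn t).
have [||x [D [z cfg]]] := walk_config optP badZ yZ low_y nbr_y PS bS yZS yS lt_st bt.
- by exists u.
- move=> s' t' v /andP[s't' t'_le] gap bst' vs vy.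
  apply: contra no_ret => vt; apply/existsP; exists (@Ordinal t.+2 t' t'_le).
  apply/existsP; exists (@Ordinal t.+2 s' (leq_trans s't' (leqW t'_le))).
  rewrite /= s't' gap /returns bst' eqxx /=.
  by apply/existsP; exists v; rewrite vs vy.
by exists (Pn s), (bn s), (Zn s), x, (yn s), D, z.
Qed.

(** * Structure of a configuration *)

Section Config.

Variables (P : {ffun G -> bool}) (b : bool) (Z : {set G}) (x y : G) (D : {set G}) (z : G).
Hypothesis cfg : config P b Z x y D z.

Lemma config_nin : x \notin D.
Proof.
apply/negP => /(subsetP (config_D cfg)).
by rewrite inE (bad_part (config_bad cfg) (config_x cfg)); case: b.
Qed.

Lemma config_flip : optimal (flip P x) /\ bad (flip P x) (~~ b) (x |: D).
Proof.
case: cfg => oP bZ xZ _ lx _ _ DP cx _ _ _ _.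
split; first by case: (bad_move oP bZ xZ lx).
by have := part_flipN P x; rewrite (bad_part bZ xZ) /bad cx => ->; rewrite setUS.
Qed.

End Config.

Lemma config_adjD P b Z x y D z w : config P b Z x y D z -> w \in D -> adj w x = adj w y.
Proof.
move=> cfg wD; have [oPx bPx] := config_flip cfg.
case: (cfg) => oP bZ xZ yZ lx ly xy DP cx cy zD lz xz.
have [oPy _] := bad_move oP bZ yZ ly.
have bPy : bad (flip P y) (~~ b) (y |: D).
  by have := part_flipN P y; rewrite (bad_part bZ yZ) /bad cy => ->; rewrite setUS.
apply: (adj_exchange (optimal_light oPx) (optimal_light oPy) bPx bPy) => //.
  exact: config_nin cfg.
apply/negP => /(subsetP DP); rewrite inE (bad_part bZ yZ); by case: (b).
Qed.

Lemma config_swap P b Z x y D z : config P b Z x y D z -> config P b Z y x D z.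
Proof.
move=> cfg; case: (cfg) => oP bZ xZ yZ lx ly xy DP cx cy zD lz xz.
by split=> //; rewrite adj_sym // -(config_adjD cfg zD) adj_sym.
Qed.

(** By [config_adjD], [w] is adjacent to [y], so moving [w] back must complete the component of [y],
    which is [Z :\ x]. *)
Lemma config_return P b Z x y D z w : config P b Z x y D z ->
  w \in D -> low w -> adj x w ->
  optimal (flip (flip P x) w) /\ bad (flip (flip P x) w) b (w |: (Z :\ x)).
Proof.
move=> cfg wD lw xw; have [oPx bPx] := config_flip cfg.
case: (cfg) => oP bZ xZ yZ lx ly xy DP _ _ _ _ _.
have [oQ [Z1]] := bad_move oPx bPx (setU1r x wD) lw.
set Q := flip (flip P x) w in oQ *; rewrite negbK => bZ1 wZ1; split=> //.
have c1 : component (part (flip P x) b) (Z1 :\ w).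
  by have := bad_del_component (optimal_light oQ) bZ1 wZ1; rewrite flipK.
have c2 := bad_del_component (optimal_light oP) bZ xZ.
have yA : y \in Z :\ x by rewrite !inE yZ eq_sym adj_neq.
have wy : adj w y by rewrite -(config_adjD cfg wD) adj_sym.
suff <- : Z1 :\ w = Z :\ x by rewrite setD1K.
apply: (component_eq c1 c2 (u := y)) => //.
rewrite !inE eq_sym adj_neq //=.
apply: (bad_closed (optimal_light oQ) bZ1 wZ1) => //.
have := part_flipN (flip P x) w; rewrite (bad_part bPx (setU1r x wD)) negbK => ->.
by case: c2 => /subsetP AP _ _ _; rewrite setU1r // AP.
Qed.

Lemma config_adj_return P b Z x y D z w u : config P b Z x y D z ->
  w \in D -> low w -> adj x w -> u \in Z :\ x -> adj u x = adj u w.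
Proof.
move=> cfg wD lw xw uA; have [oQ bQ] := config_return cfg wD lw xw.
case: (cfg) => oP bZ xZ _ _ _ _ DP _ _ _ _ _.
apply: (adj_exchange (optimal_light oP) (optimal_light oQ) _ bQ) => //.
- by rewrite setD1K.
- by rewrite setD11.
- apply/negP => /setD1P[_ wZ]; have := subsetP DP w wD.
  by rewrite inE (bad_part bZ wZ); case: (b).
Qed.

Lemma config_sym P b Z x y D z : config P b Z x y D z ->
  config (flip P x) (~~ b) (x |: D) x z (Z :\ x) y.
Proof.
move=> cfg; have [oPx bPx] := config_flip cfg.
case: (cfg) => oP bZ xZ yZ lx ly xy DP cx cy zD lz xz.
have [oQ /andP[cQ _]] := config_return cfg zD lz xz.
have [AP _ _ _] := bad_del_component (optimal_light oP) bZ xZ.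
split; rewrite ?negbK ?setU11 ?setU1r ?setD1K //; first by case/andP: bZ.
by rewrite !inE yZ eq_sym adj_neq.
Qed.

(** Brooks' theorem applies if [r b > 2]. Otherwise [x] has at most one neighbour in [Z] besides
    [y], and [twin] makes it adjacent to [y]. *)
Lemma config_clique P b Z x y D z : config P b Z x y D z -> clique Z.
Proof.
move=> cfg; case: (cfg) => oP bZ xZ yZ lx ly xy DP _ _ zD lz xz.
have lP := optimal_light oP; have /andP[cZ _] := bZ.
have degZ u : u \in Z -> deg_in Z u <= r b by move=> uZ; rewrite (bad_deg lP bZ uZ).
have [r2|r_le2] := ltnP 2 (r b); first exact: brooks cZ degZ r2.
(* Both adjacencies equal [adj u z], since [z] can replace [x] as well as [y] in [Z]. *)
have twin u : u \in Z -> u != x -> u != y -> adj u x -> adj u y.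
  move=> uZ ux uy; have yz : adj y z by rewrite adj_sym -(config_adjD cfg zD) adj_sym.
  rewrite (config_adj_return cfg zD lz xz) ?inE ?ux //.
  by rewrite (config_adj_return (config_swap cfg) zD lz yz) ?inE ?uy.
suff clN : clique (x |: (nbrs x :&: Z)) by rewrite -(clique_nbrs_crit cZ xZ clN).
have : #|(nbrs x :&: Z) :\ y| <= 1.
  have := degZ x xZ; rewrite /deg_in (cardsD1 y) !inE xy yZ => le_r.
  exact: leq_trans le_r r_le2.
move/card_le1_eqP => N1.
apply/cliqueP => u w; rewrite !inE.
move=> /orP[/eqP->|/andP[xu uZ]] /orP[/eqP->|/andP[xw wZ]] uw.
- by rewrite eqxx in uw.
- by [].
- by rewrite adj_sym.
have [uy|uy] := eqVneq u y.
  rewrite uy adj_sym; apply: twin => //; rewrite 1?adj_sym //; last by rewrite -uy eq_sym.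
  by rewrite eq_sym adj_neq.
have [wy|wy] := eqVneq w y.
  by rewrite wy; apply: twin => //; rewrite 1?adj_sym // eq_sym adj_neq.
by case/eqP: uw; apply: N1; rewrite !inE ?uy ?wy ?xu ?xw.
Qed.

(** With [A = Z :\ x], the two cliques come from a configuration and its mirror image; a low vertex
    of either side can replace [x] in the other clique, so it has the same neighbours there as
    [x]. *)
Lemma ex_clique_pair : exists x y (A D : {set G}),
  [/\ low x, low y, y \in A & x \notin A :|: D] /\
  [/\ [disjoint A & D], clique (x |: A), clique (x |: D), #|A| + #|D| = k &
      forall u w, u \in A -> w \in D -> low u || low w -> adj u w].
Proof.
have [P [b [Z [x [y [D [z cfg]]]]]]] := ex_config.
have [oPx bPx] := config_flip cfg; have cfg' := config_sym cfg.
case: (cfg) => oP bZ xZ yZ lx ly xy DP _ _ zD lz xz.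
have clZ := config_clique cfg; have clD := config_clique cfg'.
have xD := config_nin cfg; have xA := config_nin cfg'.
exists x, y, (Z :\ x), D; split; split=> //.
- by rewrite !inE yZ eq_sym adj_neq.
- by rewrite inE negb_or xA.
- rewrite -setI_eq0; apply/eqP/setP => u; rewrite !inE.
  apply/negP => /andP[/andP[_ uZ] /(subsetP DP)].
  by rewrite inE (bad_part bZ uZ); case: (b).
- by rewrite setD1K.
- have := deg_clique clZ xZ; rewrite (bad_deg (optimal_light oP) bZ xZ).
  have := deg_clique clD (setU11 x D); rewrite (bad_deg (optimal_light oPx) bPx (setU11 x D)).
  by rewrite (cardsD1 x Z) xZ cardsU1 xD !add1n /= => <- <-; rewrite rD.
have adjA u : u \in Z :\ x -> adj x u.
  by case/setD1P => ux uZ; apply: (cliqueP _ clZ); rewrite // eq_sym.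
have adjD w : w \in D -> adj x w.
  move=> wD; apply: (cliqueP _ clD); rewrite ?setU11 ?setU1r //.
  by apply: contraNneq xD => ->.
move=> u w uA wD /orP[lu|lw].
  rewrite adj_sym -(config_adj_return cfg' uA lu (adjA u uA)) ?setU1K //.
  by rewrite adj_sym adjD.
by rewrite -(config_adj_return cfg wD lw (adjD w wD) uA) adj_sym adjA.
Qed.

End Bipartitions.

(** * Two cliques through [x] merge into one on [k + 1] vertices *)

Section Endgame.

Variables (G : sgraph) (k : nat).
Hypotheses (k_gt2 : 2 < k) (cG : crit k [set: G]) (degG : forall v : G, degree v <= k.+1).
Hypothesis high_clique : forall S : {set G},
  clique S -> {in S, forall v, k < degree v} -> #|S| <= k.+1 %/ 2 - 2.
Implicit Types (u v w : G) (S U : {set G}).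

Lemma extend_greedy (f : G -> 'I_k) S U : S \subset U -> proper_on f S ->
  (forall v, v \in U :\: S -> deg_in U v < k) ->
  exists2 g : G -> 'I_k, proper_on g U & {in S, g =1 f}.
Proof.
have [n le_n] := ubnP #|U :\: S|; elim: n => // n IH in f S le_n * => SU fP degU.
have [US0|[v vUS]] := set_0Vmem (U :\: S).
  by exists f => //; apply: proper_onS fP; rewrite -setD_eq0 US0.
have /setDP[vU vS] := vUS.
have [|c cP] := @extend_deg _ _ f S v fP.
  by apply: leq_ltn_trans (degU v vUS); apply/subset_leq_card/setIS.
have [||v' v'U|g gP gE] := IH (update f v c) (v |: S) _ _ cP.
- rewrite -ltnS; apply: leq_trans le_n; rewrite ltnS; apply: proper_card.
  apply/properP; split; first by apply/setDS/subsetUr.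
  by exists v; rewrite // !inE eqxx.
- by rewrite subUset sub1set vU.
- by apply: degU; move: v'U; rewrite !inE negb_or => /andP[/andP[_ ->]].
exists g => // u uS; rewrite gE ?setU1r // /update.
by case: eqP => // uv; rewrite -uv uS in vS.
Qed.

Variables (x y : G) (A D : {set G}).
Hypotheses (low_x : degree x <= k) (low_y : degree y <= k).
Hypotheses (yA : y \in A) (xAD : x \notin A :|: D) (AD : [disjoint A & D]).
Hypotheses (clA : clique (x |: A)) (clD : clique (x |: D)) (cardAD : #|A| + #|D| = k).
Hypothesis low_adj : forall u w, u \in A -> w \in D ->
  (degree u <= k) || (degree w <= k) -> adj u w.

Let K := x |: (A :|: D).

Let adjA u v : u \in A -> v \in A -> u != v -> adj u v.
Proof. by move=> uA vA; apply: (cliqueP _ clA); rewrite setU1r. Qed.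

Let adjD u v : u \in D -> v \in D -> u != v -> adj u v.
Proof. by move=> uD vD; apply: (cliqueP _ clD); rewrite setU1r. Qed.

Let adj_x v : v \in A :|: D -> adj x v.
Proof.
move=> vAD; have xv : x != v by apply: contraNneq xAD => ->.
case/setUP: vAD => vS; first by apply: (cliqueP _ clA); rewrite ?setU11 ?setU1r.
by apply: (cliqueP _ clD); rewrite ?setU11 ?setU1r.
Qed.

Let adj_y v : v \in K -> v != y -> adj y v.
Proof.
move=> /setU1P[->|/setUP[vA|vD]] vy.
- by rewrite adj_sym adj_x // inE yA.
- by rewrite adjA // eq_sym.
- by rewrite low_adj ?low_y.
Qed.

Let cardK : #|K| = k.+1.
Proof. by rewrite cardsU1 xAD cardsU disjoint_setI0 // cards0 subn0 cardAD. Qed.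

Let highs S : clique S -> #|S :&: [set v | k < degree v]| <= k.+1 %/ 2 - 2.
Proof.
move=> /cliqueP clS; apply: high_clique => [|v]; last by rewrite !inE => /andP[].
by apply/cliqueP => u v /setIP[uS _] /setIP[vS _]; apply: clS.
Qed.

(** As [#|K| = k.+1] bounds the degree, [u] has at most as many neighbours outside [K] as it misses
    in [K], itself included. By [k_gt2] the subtractions do not truncate. *)
Let deg_out S u : clique S -> k.+1 <= deg_in K u + #|S :&: [set v | k < degree v]| + 1 ->
  deg_in (~: K) u <= k.+1 %/ 2 - 1.
Proof.
move=> clS; have := highs clS; have := degG u; rewrite /degree -(cardsID K).
rewrite setDE -/(deg_in K u) -/(deg_in (~: K) u).
by move: k_gt2; clear; lia.
Qed.

(** Low vertices are joined to everything across, so in [K] the vertex [u] misses only itself and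
    high vertices of the clique [D]. *)
Let nonadj_out_A u w : u \in A -> w \in D -> ~~ adj u w ->
  deg_in (~: K) u <= k.+1 %/ 2 - 1.
Proof.
move=> uA wD nuw; apply: (@deg_out D).
  by apply/cliqueP => a c aD cD; apply: adjD.
have hu : k < degree u by rewrite ltnNge; apply: contra nuw => lu; rewrite low_adj ?lu.
have /subset_leq_card : K \subset
    (nbrs u :&: K) :|: (D :&: [set v | k < degree v]) :|: [set u].
  apply/subsetP => v vK; rewrite !inE; have := vK; rewrite !inE.
  have [_|vu /=] := eqVneq v u; rewrite ?orbT // orbF.
  case/or3P => [/eqP->|vA|vD]; first by rewrite adj_sym adj_x ?eqxx // inE uA.
    by rewrite adjA ?vA ?orbT // eq_sym.
  rewrite vD !orbT /= andbT; have [lv|] := leqP (degree v) k; last by rewrite orbT.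
  by rewrite low_adj ?lv ?orbT.
rewrite cardK => /leq_trans; apply; apply: leq_trans (leq_card_setU _ _) _.
by rewrite cards1 leq_add2r (leq_of_leqif (leq_card_setU _ _)).
Qed.

Let nonadj_out_D u w : u \in A -> w \in D -> ~~ adj u w ->
  deg_in (~: K) w <= k.+1 %/ 2 - 1.
Proof.
move=> uA wD nuw; apply: (@deg_out A).
  by apply/cliqueP => a c aA cA; apply: adjA.
have hw : k < degree w by rewrite ltnNge; apply: contra nuw => lw; rewrite low_adj ?lw ?orbT.
have /subset_leq_card : K \subset
    (nbrs w :&: K) :|: (A :&: [set v | k < degree v]) :|: [set w].
  apply/subsetP => v vK; rewrite !inE; have := vK; rewrite !inE.
  have [_|vw /=] := eqVneq v w; rewrite ?orbT // orbF.
  case/or3P => [/eqP->|vA|vD]; first by rewrite adj_sym adj_x ?eqxx // inE wD orbT.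
    rewrite vA !orbT /= andbT; have [lv|] := leqP (degree v) k; last by rewrite orbT.
    by rewrite adj_sym low_adj ?lv.
  by rewrite adjD ?vD ?orbT // eq_sym.
rewrite cardK => /leq_trans; apply; apply: leq_trans (leq_card_setU _ _) _.
by rewrite cards1 leq_add2r (leq_of_leqif (leq_card_setU _ _)).
Qed.

(* If [u] and [w] were not adjacent, a colouring of the complement of [K] could be extended
   by giving them a common colour, which saves one colour at [x]; the vertices [x] and [y] are
   coloured last. *)
Lemma across_adj u w : u \in A -> w \in D -> adj u w.
Proof.
move=> uA wD; apply: contraT => nuw.
have xK : x \in K by rewrite setU11.
have uK : u \in K by rewrite !inE uA orbT.
have wK : w \in K by rewrite !inE wD !orbT.
have xu : adj x u by apply: adj_x; rewrite inE uA.
have xw : adj x w by apply: adj_x; rewrite inE wD orbT.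
have uy : u != y by apply: contra nuw => /eqP->; rewrite low_adj ?low_y.
have wy : w != y.
  by apply: contraTneq wD => ->; rewrite (disjointFr AD yA).
have uw : u != w.
  by apply: contraTneq wD => <-; rewrite (disjointFr AD uA).
have xy : adj x y by apply: adj_x; rewrite inE yA.
have [f fP] := crit_col cG (in_setT x).
have fK : proper_on f (~: K).
  by apply: proper_onS fP; apply/subsetP => v; rewrite !inE negb_or => /andP[->].
have [c] : exists c, c \notin f @: (nbrs u :&: ~: K) :|: f @: (nbrs w :&: ~: K).
  (* The two vertices have at most [2 * (k.+1 %/ 2 - 1) < k] neighbours outside [K]. *)
  have out_lt : #|f @: (nbrs u :&: ~: K) :|: f @: (nbrs w :&: ~: K)| < k.
    apply: leq_ltn_trans (leq_card_setU _ _) _.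
    apply: leq_ltn_trans (leq_add (leq_imset_card _ _) (leq_imset_card _ _)) _.
    have := nonadj_out_A uA wD nuw; have := nonadj_out_D uA wD nuw.
    by rewrite /deg_in; move: k_gt2; clear; lia.
  apply/existsP; apply: contraT => /existsPn nc; move: out_lt.
  rewrite (_ : _ :|: _ = setT) ?cardsT ?card_ord ?ltnn //.
  by apply/setP => c; rewrite [RHS]inE; apply/negbNE/nc.
rewrite inE negb_or => /andP[cu cw].
pose f2 := update (update f u c) w c.
have f2P : proper_on f2 (w |: (u |: ~: K)).
  apply: proper_update; first apply: proper_update => //.
    move=> v vK uv; apply: contraNneq cu => <-; apply: imset_f.
    by rewrite !inE uv; move: vK; rewrite !inE.
  move=> v /setU1P[->|vK] wv; first by rewrite adj_sym wv in nuw.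
  rewrite /update; case: (v =P u) => [vu|_]; first by rewrite vu inE uK in vK.
  by apply: contraNneq cw => <-; apply: imset_f; rewrite inE vK inE wv.
pose U := ~: [set x; y].
have SU : w |: (u |: ~: K) \subset U.
  apply/subsetP => v; rewrite !inE !negb_or => /or3P[/eqP->|/eqP->|/and3P[-> vA _]] /=.
  - by rewrite wy eq_sym adj_neq.
  - by rewrite uy eq_sym adj_neq.
  - by apply: contraNneq vA => ->.
(* Outside [U], the vertex [v] has the neighbour [x], and also [y] unless it is [y] itself. *)
have degU v : v \in K -> v != x -> deg_in U v + (v != y) < degree v.
  move=> /setU1P[->|vAD]; rewrite ?eqxx // => vx.
  have vxy : (v != y).+1 <= #|nbrs v :&: [set x; y]|.
    have [->|vy] := eqVneq v y.
      by apply/card_gt0P; exists x; rewrite !inE eqxx adj_sym xy.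
    have nxy := adj_neq xy; rewrite (_ : _ :&: _ = [set x; y]) ?cards2 ?nxy //.
    apply/setIidPr/subsetP => a; rewrite !inE => /orP[] /eqP->; rewrite adj_sym.
      exact: adj_x.
    by apply: adj_y => //; rewrite setU1r.
  rewrite /degree -(cardsID [set x; y] (nbrs v)) addnC -addSn setDE.
  by rewrite -/(deg_in U v) leq_add2r.
have [v vU|g gP gE] := extend_greedy SU f2P.
  case/setDP: vU => vU vS.
  have vK : v \in K by apply: contraR vS => nvK; rewrite in_setU in_setU in_setC nvK !orbT.
  have [vx vy] : v != x /\ v != y by move: vU; rewrite !inE negb_or => /andP[].
  have := degU v vK vx; rewrite vy addn1 => lt_deg.
  by rewrite -ltnS (leq_trans lt_deg (degG v)).
have gu : g u = c.
  by rewrite gE ?inE ?eqxx ?orbT // /f2 /update eqxx; case: eqP.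
have gw : g w = c by rewrite gE ?inE ?eqxx // /f2 /update eqxx.
have yK : y \in K by rewrite !inE yA orbT.
have yx : y != x by rewrite eq_sym adj_neq.
have [|cy g1P] := @extend_deg _ _ g U y gP.
  by have := degU y yK yx; rewrite eqxx addn0 => /leq_trans; apply.
set g1 := update g y cy in g1P.
have g1u : g1 u = c by rewrite /g1 /update (negPf uy).
have g1w : g1 w = c by rewrite /g1 /update (negPf wy).
have yU v : v != x -> v \in y |: U.
  by move=> vx; rewrite !inE (negPf vx) orbN.
(* The low vertex [x] has at most [k] neighbours, and [u] and [w] share the colour [c]. *)
have [|cx hP] := @extend _ _ g1 _ x g1P.
  set S := nbrs x :&: _.
  have inS v : adj x v -> v \in S.
    by move=> xv; rewrite in_setI inE xv yU // eq_sym adj_neq.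
  have /subset_leq_card : g1 @: S \subset g1 @: (S :\ u).
    apply/subsetP => _ /imsetP[v vS ->]; have [->|vu] := eqVneq v u.
      by rewrite g1u -g1w; apply: imset_f; rewrite in_setD1 eq_sym uw inS.
    by apply: imset_f; rewrite in_setD1 vu.
  move/leq_ltn_trans; apply; apply: leq_ltn_trans (leq_imset_card _ _) _.
  apply: leq_trans low_x; rewrite -ltnS [#|_ :\ _|.+1](_ : _ = #|S|).
    by rewrite ltnS; apply/subset_leq_card/subsetIl.
  by rewrite (cardsD1 u S) inS.
case: (crit_ncol cG); apply/colorable_onP; exists (update g1 x cx).
apply: proper_onS hP; apply/subsetP => v _; rewrite in_setU1.
by case: (eqVneq v x) => //= /yU.
Qed.

Lemma pair_clique : clique K.
Proof.
apply/cliqueP => u v; rewrite !inE.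
move=> /or3P[/eqP->|uA|uD] /or3P[/eqP->|vA|vD] uv.
- by rewrite eqxx in uv.
- by rewrite adj_x ?inE ?vA.
- by rewrite adj_x ?inE ?vD ?orbT.
- by rewrite adj_sym adj_x ?inE ?uA.
- exact: adjA.
- exact: across_adj.
- by rewrite adj_sym adj_x ?inE ?uD ?orbT.
- by rewrite adj_sym across_adj.
- exact: adjD.
Qed.

End Endgame.

(** * The even split of [k], and the clique on all vertices *)

Section HighClique.

Variables (G : sgraph) (k : nat).
Hypotheses (k_gt4 : 4 < k) (cG : crit k [set: G]) (degG : forall v : G, degree v <= k.+1).
Hypothesis high_clique : forall S : {set G},
  clique S -> {in S, forall v, k < degree v} -> #|S| <= k.+1 %/ 2 - 2.

Definition split_half (b : bool) : nat := if b then k %/ 2 else k - k %/ 2.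

Lemma split_halfD : split_half true + split_half false = k.
Proof. by rewrite /split_half; lia. Qed.

Lemma split_half_ge b : k %/ 2 <= split_half b.
Proof. by case: b; rewrite /split_half; lia. Qed.

Lemma ex_adj_low (P : {ffun G -> bool}) b (Z : {set G}) :
  light split_half P -> bad split_half P b Z ->
  exists x y, [/\ x \in Z, y \in Z, low split_half x, low split_half y & adj x y].
Proof.
have cG' := cG; have degG' := degG; rewrite -split_halfD in cG' degG'.
move=> lP bZ; have /andP[cZ _] := bZ; have degZ := bad_deg cG' degG' lP bZ.
have half := split_half_ge b.
pose L := [set v : G | degree v <= k].
have card_high (S : {set G}) : clique S -> #|S :\: L| <= k.+1 %/ 2 - 2.
  move=> /cliqueP clS; apply: high_clique => [|v]; last by rewrite !inE -ltnNge => /andP[].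
  by apply/cliqueP => u v /setDP[uS _] /setDP[vS _]; apply: clS.
rewrite /low split_halfD; have [r2|r_le2] := ltnP 2 (split_half b).
  have clZ : clique Z by apply: (brooks cZ) r2 => u /degZ->.
  have /set0Pn[v vZ] : Z != set0 by apply: crit_neq0 cZ; apply: leq_trans r2.
  (* The clique [Z] has at least [k %/ 2 + 1] vertices, of which at most [k.+1 %/ 2 - 2] are
     high. *)
  have : 1 < #|Z :&: L|.
    have := card_high Z clZ; have := cardsID L Z.
    have := crit_deg cZ vZ; rewrite deg_clique //.
    by move: half k_gt4; clear; lia.
  case/card_gt1P => x [y [/setIP[xZ xL] /setIP[yZ yL] xy]].
  exists x, y; split=> //; first by rewrite inE in xL.
    by rewrite inE in yL.
  exact: (cliqueP _ clZ).
have [/existsP[x /existsP[y /and5P[*]]]|/existsPn none] :=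
  boolP [exists x, exists y, [&& x \in Z, y \in Z, degree x <= k, degree y <= k & adj x y]].
  by exists x, y.
case: (crit_ncol cZ); apply/colorable_onP.
have r_gt1 : 1 < split_half b by apply: leq_trans half; move: k_gt4; clear; lia.
(* Low and high vertices get one colour each. Here [k = 5], so a clique has at most one high vertex
   and no two high vertices are adjacent. *)
exists (fun v => if v \in L then Ordinal (ltnW r_gt1) else Ordinal r_gt1) => u v uZ vZ uv.
have [uL|uL] := boolP (u \in L); have [vL|vL] := boolP (v \in L) => //.
  move=> _; have /existsPn/(_ v) := none u; rewrite uZ vZ uv.
  by move: uL vL; rewrite !inE => -> ->.
have /card_high : clique [set u; v].
  apply/cliqueP => a c; rewrite !inE => /orP[] /eqP-> /orP[] /eqP->;
    by rewrite ?eqxx // adj_sym.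
have -> : [set u; v] :\: L = [set u; v].
  by apply/setDidPl; rewrite -setI_eq0; apply/eqP/setP => a; rewrite in_setI in_set0 !inE;
    apply/negP => /andP[/orP[] /eqP->]; rewrite -?(in_set (fun v => degree v <= k)); apply/negP.
rewrite cards2 adj_neq //.
by move: half r_le2 k_gt4; clear; lia.
Qed.

Lemma ex_big_clique : exists2 K : {set G}, clique K & k < #|K|.
Proof.
have cG' := cG; have degG' := degG; rewrite -split_halfD in cG' degG'.
have r_gt1 b : 1 < split_half b.
  by apply: leq_trans (split_half_ge b); move: k_gt4; clear; lia.
have := ex_clique_pair cG' degG' r_gt1 ex_adj_low.
case=> x [y [A [D [[lx ly yA xAD] [AD clA clD]]]]].
rewrite /low split_halfD in lx ly * => cardAD low_adj.
exists (x |: (A :|: D)).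
  by apply: (pair_clique (ltnW (ltnW k_gt4)) cG degG high_clique lx ly yA).
by rewrite cardsU1 xAD cardsU disjoint_setI0 // cards0 subn0 cardAD.
Qed.

(** By criticality a clique on more than [k] vertices is everything; without one vertex it is
    [k]-colourable, so at most [k] vertices remain. *)
Lemma clique_all : clique [set: G] /\ #|G| = k.+1.
Proof.
have [K clK cardK] := ex_big_clique.
have KT := crit_eq cG (subsetT K) (clique_ncol clK cardK).
rewrite KT in clK cardK; split=> //; apply/eqP; rewrite eqn_leq -cardsT cardK andbT.
have /card_gt0P[v vT] : 0 < #|[set: G]| by apply: leq_trans cardK.
have [f fP] := crit_col cG vT; rewrite (cardsD1 v) vT add1n ltnS leqNgt.
apply/negP => /clique_ncol; apply; last by apply/colorable_onP; exists f.
by apply/cliqueP => u w _ _; apply: (cliqueP _ clK).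
Qed.

End HighClique.

(** * Translation to chromatic and clique numbers, and the theorem *)

Lemma colorable_onT (G : sgraph) k : colorable_on k [set: G] = colorable G k.
Proof.
apply/colorable_onP/existsP => [[f fP]|[f /forallP fP]].
  exists [ffun v => f v]; apply/forallP => u; apply/forallP => v; apply/implyP => uv.
  by rewrite !ffunE; apply/eqP/fP.
by exists f => u v _ _ uv; apply/eqP; have /forallP/(_ v)/implyP := fP u; apply.
Qed.

Lemma colorable_on_chromatic (G : sgraph) : colorable_on (chromatic_number G) [set: G].
Proof. by rewrite colorable_onT /chromatic_number; case: ex_minnP. Qed.

Lemma chromatic_le (G : sgraph) k : colorable_on k [set: G] -> chromatic_number G <= k.
Proof. by rewrite colorable_onT /chromatic_number; case: ex_minnP => m _ /(_ k). Qed.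

Lemma colorable_on_leq (G : sgraph) (S : {set G}) j k :
  j <= k -> colorable_on j S -> colorable_on k S.
Proof.
move=> jk /colorable_onP[f fP]; apply/colorable_onP.
exists (fun v => widen_ord jk (f v)) => u v uS vS uv /(congr1 val) /= fuv.
by apply: (fP u v uS vS uv); apply: val_inj.
Qed.

Lemma colorable_on_induced (G : sgraph) (S : {set G}) k : 0 < k ->
  colorable_on k [set: induced S] -> colorable_on k S.
Proof.
move=> k0 /colorable_onP[f fP]; apply/colorable_onP.
(* The default colour outside [S] is arbitrary; [k0] guarantees that one exists. *)
exists (fun v => if insub v is Some s then f (s : induced S) else Ordinal k0) => u v uS vS uv.
by rewrite !insubT; apply: fP.
Qed.

Lemma critical_crit (G : sgraph) k :
  critical G -> chromatic_number G = k.+1 -> 0 < k -> crit k [set: G].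
Proof.
move=> critG chiG k0; apply/andP; split.
  by apply/negP => /chromatic_le; rewrite chiG ltnn.
apply/forall_inP => v _; rewrite setTD.
have := critG v; rewrite chiG ltnS => le_k.
by apply: colorable_on_induced k0 _; apply: colorable_on_leq le_k (colorable_on_chromatic _).
Qed.

Lemma leq_high_clique (G : sgraph) (S : {set G}) : clique S ->
  {in S, forall v, chromatic_number G <= degree v} ->
  #|S| <= clique_number (high_subgraph G).
Proof.
move=> /cliqueP clS highS.
pose S' : {set high_subgraph G} := [set v | val v \in S].
have -> : #|S| = #|S'|.
  have inH v : v \in S -> v \in [set v : G | chromatic_number G <= degree v].
    by move=> vS; rewrite inE highS.
  rewrite -(card_imset (mem S') val_inj); apply: eq_card => v.
  apply/idP/imsetP => [vS|[u uS' ->]]; last by rewrite inE in uS'.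
  by exists (Sub v (inH v vS)); rewrite ?inE ?SubK.
apply: leq_bigmax_cond; apply/cliqueP => u v; rewrite !inE => uS vS uv.
exact: clS.
Qed.

Theorem theoremM (G : sgraph) :
  critical G ->
  max_degree G <= chromatic_number G ->
  6 <= max_degree G ->
  clique_number (high_subgraph G) <= max_degree G %/ 2 - 2 ->
  isomorphic G (complete (chromatic_number G)).
Proof.
move=> critG Delta_chi Delta6 omegaH.
have [k chiG] : exists k, chromatic_number G = k.+1.
  by exists (chromatic_number G).-1; rewrite prednK //; apply: leq_trans Delta_chi; apply: leq_trans Delta6.
have k_gt4 : 4 < k by move: Delta_chi Delta6; rewrite chiG; clear; lia.
have degG (v : G) : degree v <= k.+1.
  by rewrite -chiG; apply: leq_trans Delta_chi; apply: leq_bigmax.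
have cG : crit k [set: G] by apply: critical_crit => //; apply: leq_trans k_gt4.
have high_clique (S : {set G}) :
    clique S -> {in S, forall v, k < degree v} -> #|S| <= k.+1 %/ 2 - 2.
  move=> clS highS; apply: leq_trans (leq_high_clique clS _) _; first by rewrite chiG.
  by apply: leq_trans omegaH _; rewrite leq_sub2r // leq_div2r // -chiG.
have [/cliqueP adjG cardG] := clique_all k_gt4 cG degG high_clique.
have E : #|G| = chromatic_number G by rewrite cardG.
(* Any bijection will do, as both graphs are complete. *)
exists (fun v => cast_ord E (enum_rank v)).
  by apply: (bij_comp _ (@enum_rank_bij G)); exists (cast_ord (esym E)); [apply: cast_ordK | apply: cast_ordKV].
move=> u v; rewrite /= /complete_adj (inj_eq (@cast_ord_inj _ _ E)) (inj_eq enum_rank_inj).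
have [->|uv] := eqVneq u v; first by rewrite adj_irrefl.
by rewrite adjG ?inE.
Qed.
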